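(* Let $G$ and $H$ be locally compact groups, let $A=A_\pi$ be a closed unital translation-invariant subalgebra of $B(G)$, and let $\varphi=j_\alpha: A\to B(H)$ be a homomorphism, where $\alpha: Y\to\Delta(A)$ is continuous on the open set $Y\subseteq H$. The following statements are equivalent: (i) $\varphi$ is 4-positive and $\alpha(Y)$ is contained in a subgroup of $\Delta(A)$; (ii) $\varphi$ is completely positive and $\alpha(Y)$ is contained in a subgroup of $\Delta(A)$; (iii) $Y$ is an open subgroup $H_\alpha$ of $H$ and $\alpha: H_\alpha\to\Delta(A)$ is a continuous homomorphism (into $D_p$ for some projection $p$ in $\Delta(A)$).
   Context: $B(G)$ is the Fourier–Stieltjes algebra. For a continuous unitary representation $\{\pi,\mathcal H_\pi\}$ of $G$, $A_\pi$ is the closed linear span in $B(G)$ of the functions $\xi*_\pi\eta(s)=\langle\pi(s)\xi|\eta\rangle$, and $VN_\pi$ is the von Neumann algebra generated by $\pi(G)$, identified with $A_\pi^*$ via $\langle T,\xi*_\pi\eta\rangle=\langle T\xi|\eta\rangle$. Closed translation-invariant subspaces of $B(G)$ are exactly the $A_\pi$'s. $W^*(H)=B(H)^*$. $\Delta(A)\subseteq A^*=VN_\pi$ is the Gelfand spectrum with the weak$^*$-topology; for unital $A$ it is a compact semitopological $*$-semigroup under the product and involution of $VN_\pi$. A subgroup of $\Delta(A)$ is a subset that is a group under the multiplication of $\Delta(A)$ (its identity being an idempotent). For a projection $p\in\Delta(A)$, $D_p:=\{x\in\Delta(A):x^*x=xx^*=p\}$, a topological group with identity $p$ and inversion $x\mapsto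 x^*$. Every homomorphism $\varphi:A\to B(H)$ has the form $\varphi=j_\alpha$ for a unique open $Y\subseteq H$ and continuous $\alpha:Y\to\Delta(A)$, where $j_\alpha(u)(h)=\langle\alpha(h),u\rangle$ for $h\in Y$ and $0$ for $h\in H\setminus Y$. $\varphi$ is 4-positive (completely positive) when its dual map $\varphi^*:W^*(H)\to VN_\pi$ is 4-positive (completely positive).
   Formalization: The homomorphism φ is assumed nonzero: for φ = 0 the set Y is empty, so (i) and (ii) hold trivially while (iii) fails because the empty set is not a subgroup of H. *)

(* Defs.v *)
From HB Require Import structures.
From mathcomp Require Import all_boot all_order all_algebra.
From mathcomp Require Import complex.
From mathcomp Require Import all_classical all_reals all_analysis.
Set Implicit Arguments.
Unset Strict Implicit.
Unset Printing Implicit Defensive.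
Import Order.TTheory GRing.Theory Num.Theory.
Import numFieldNormedType.Exports.
Local Open Scope classical_set_scope.
Local Open Scope ring_scope.
Local Open Scope complex_scope.

HB.mixin Record isLocallyCompactGroup G of Group G & Topological G := {
  mulg_continuous : continuous (fun x : G * G => (x.1 * x.2)%g);
  invg_continuous : continuous (fun x : G => x^-1%g);
  lcgroup_hausdorff : hausdorff_space G;
  lcgroup_locally_compact : locally_compact [set: G]
}.

#[short(type="lcGroupType")]
HB.structure Definition LocallyCompactGroup :=
  {G of isLocallyCompactGroup G & Group G & Topological G}.

HB.mixin Record isHilbert (R : realType) V of CompleteNormedModule R[i] V := {
  inner : V -> V -> R[i];
  inner_linear : forall z : V, linear_for *%R (inner^~ z);
  inner_conj : forall x y : V, inner y x = Num.conj (inner x y);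
  inner_norm : forall x : V, inner x x = `|x| ^+ 2
}.

#[short(type="hilbertType")]
HB.structure Definition Hilbert (R : realType) :=
  {V of isHilbert R V & CompleteNormedModule R[i] V}.

Section Representations.
Variables (R : realType) (G : lcGroupType).
Local Notation C := R[i].

Definition cts_unitary_rep (V : hilbertType R) (pi : G -> V -> V) : Prop :=
  [/\ forall s, linear (pi s),
      forall s x y, inner (pi s x) (pi s y) = inner x y,
      pi 1%g = id,
      forall s t, pi (s * t)%g = pi s \o pi t &
      forall x, continuous (fun s => pi s x)].

(* xi *_pi eta *)
Definition coef (V : hilbertType R) (pi : G -> V -> V) (xi eta : V) : G -> C :=
  fun s => inner (pi s xi) eta.

(* The Fourier-Stieltjes algebra B(G) (Eymard): all coefficient functions of
   continuous unitary representations, ... *)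
Definition fourier_stieltjes : set (G -> C) :=
  [set u | exists (V : hilbertType R) (pi : G -> V -> V) (xi eta : V),
     cts_unitary_rep pi /\ u = coef pi xi eta].

(* ... normed by the infimum of |xi| |eta| over the ways of writing
   u = xi *_pi eta; only meaningful on B(G). *)
Definition fs_norm (u : G -> C) : R :=
  inf [set r | exists (V : hilbertType R) (pi : G -> V -> V) (xi eta : V),
     [/\ cts_unitary_rep pi, u = coef pi xi eta & r%:C = `|xi| * `|eta|]].

Definition fs_closure (E : set (G -> C)) : set (G -> C) :=
  [set u | fourier_stieltjes u /\
     forall e : R, 0 < e -> exists2 v, E v & fs_norm (u \- v) < e].

Definition coef_span (V : hilbertType R) (pi : G -> V -> V) : set (G -> C) :=
  [set u | exists n (c : 'I_n -> C) (xi eta : 'I_n -> V),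
     u = fun s => \sum_i c i * coef pi (xi i) (eta i) s].

(* A_pi *)
Definition coef_space (V : hilbertType R) (pi : G -> V -> V) : set (G -> C) :=
  fs_closure (coef_span pi).

Record closed_unital_invariant_subalgebra (A : set (G -> C)) : Prop := {
  subalg_sub : A `<=` fourier_stieltjes;
  subalg_closed : fs_closure A `<=` A;
  subalg_one : A (fun=> 1);
  subalg_linear : forall (c : C) u v, A u -> A v -> A (fun s => c * u s + v s);
  subalg_mul : forall u v, A u -> A v -> A (fun s => u s * v s);
  subalg_lshift : forall t u, A u -> A (fun s => u (t * s)%g);
  subalg_rshift : forall t u, A u -> A (fun s => u (s * t)%g)
}.

(* f restricts to an element of the Banach space dual of the subspace E of
   B(G); its values outside E are irrelevant. *)
Definition dual_of (E : set (G -> C)) (f : (G -> C) -> C) : Prop :=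
  (forall (c : C) u v, E u -> E v ->
     f (fun s => c * u s + v s) = c * f u + f v) /\
  (exists M : R, forall u, E u -> `|f u| <= (M * fs_norm u)%:C).

End Representations.

Section VonNeumann.
Variables (R : realType) (V : hilbertType R).

Definition bounded_op : set (V -> V) := [set T | linear T /\ continuous T].

Definition is_adjoint (S T : V -> V) : Prop :=
  forall x y, inner (S x) y = inner x (T y).

Definition commutant (S : set (V -> V)) : set (V -> V) :=
  [set T | bounded_op T /\ forall X, S X -> T \o X = X \o T].

Definition von_neumann_algebra (M : set (V -> V)) : Prop :=
  (forall S T, M T -> bounded_op S -> is_adjoint S T -> M S) /\
  commutant (commutant M) = M.

Definition is_projection (p : V -> V) : Prop := p \o p = p /\ is_adjoint p p.

End VonNeumann.

Section Spectrum.
Variables (R : realType) (G : lcGroupType) (V : hilbertType R).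
Variable pi : G -> V -> V.
Local Notation C := R[i].
Local Notation A := (coef_space pi).

(* VN_pi *)
Definition vn_rep : set (V -> V) :=
  smallest (@von_neumann_algebra R V) (range pi).

(* The identification VN_pi = A_pi^*: T corresponds to the functional f with
   f (xi *_pi eta) = <T xi | eta>.  Such an f is unique on A_pi. *)
Definition represents (T : V -> V) (f : (G -> C) -> C) : Prop :=
  dual_of A f /\ forall xi eta, f (coef pi xi eta) = inner (T xi) eta.

(* <T, u> *)
Definition pairing (T : V -> V) (u : G -> C) : C :=
  xget (fun=> 0) [set f | represents T f] u.

(* Delta(A_pi), as a set of operators in VN_pi *)
Definition spectrum : set (V -> V) :=
  [set T | vn_rep T /\ exists f, [/\ represents T f,
     forall u v, A u -> A v -> f (fun s => u s * v s) = f u * f v &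
     exists2 u, A u & f u != 0]].

Definition subgroup_of_spectrum (S : set (V -> V)) : Prop :=
  [/\ S `<=` spectrum,
      forall x y, S x -> S y -> S (x \o y) &
      exists2 e, S e & forall x, S x -> [/\ e \o x = x, x \o e = x &
        exists2 y, S y & y \o x = e /\ x \o y = e]].

(* D_p = {x in Delta(A) : x^* x = x x^* = p} *)
Definition spectrum_block (p : V -> V) : set (V -> V) :=
  [set x | spectrum x /\
     exists y, [/\ bounded_op y, is_adjoint y x, y \o x = p & x \o y = p]].

(* Continuity on Y for the weak-* topology of Delta(A), i.e. the topology of
   pointwise convergence on A; R[i]^o is R[i] with its norm topology. *)
Definition weakstar_continuous_on (H : topologicalType) (Y : set H)
    (alpha : H -> V -> V) : Prop :=
  {within Y, continuous
    ((fun h (u : A) => pairing (alpha h) (\val u)) : H -> {ptws A -> R[i]^o})}.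

(* j_alpha; the values of alpha outside Y are ignored. *)
Definition jmap (H : Type) (Y : set H) (alpha : H -> V -> V) (u : G -> C) :
  H -> C := fun h => if h \in Y then pairing (alpha h) u else 0.

End Spectrum.

Section Positivity.
Variable R : realType.
Local Notation C := R[i].

(* A matrix of functionals T i j on A_sigma, read in M_n(VN_sigma): it is a
   positive operator on the n-fold sum of V, where
   <T_ij xi_j | xi_i> = <T_ij, xi_j *_sigma xi_i>. *)
Definition mx_positive (G : lcGroupType) (V : hilbertType R)
    (sigma : G -> V -> V) n (T : 'I_n -> 'I_n -> (G -> C) -> C) : Prop :=
  forall xi : 'I_n -> V,
    0 <= \sum_i \sum_j T i j (coef sigma (xi j) (xi i)).

(* Positivity in M_n(W^*(H)), W^*(H) = B(H)^* being the von Neumann algebra of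
   the universal representation, the direct sum of all continuous unitary
   representations: a matrix over it is positive iff it acts as a positive
   operator on every summand. *)
Definition wstar_mx_positive (H : lcGroupType) n
    (T : 'I_n -> 'I_n -> (H -> C) -> C) : Prop :=
  (forall i j, dual_of (@fourier_stieltjes R H) (T i j)) /\
  forall (W : hilbertType R) (sigma : H -> W -> W),
    cts_unitary_rep sigma -> mx_positive sigma T.

Variables (G H : lcGroupType) (V : hilbertType R) (pi : G -> V -> V).

Definition algebra_hom (A : set (G -> C)) (B : set (H -> C))
    (phi : (G -> C) -> H -> C) : Prop :=
  [/\ forall u, A u -> B (phi u),
      forall (c : C) u v, A u -> A v ->
        phi (fun s => c * u s + v s) = (fun h => c * phi u h + phi v h) &
      forall u v, A u -> A v ->
        phi (fun s => u s * v s) = (fun h => phi u h * phi v h)].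

(* n-positivity of the dual map phi^* : W^*(H) -> A_pi^* = VN_pi, T |-> T o phi *)
Definition n_positive n (phi : (G -> C) -> H -> C) : Prop :=
  forall T : 'I_n -> 'I_n -> (H -> C) -> C, wstar_mx_positive T ->
    mx_positive pi (fun i j => T i j \o phi).

Definition completely_positive (phi : (G -> C) -> H -> C) : Prop :=
  forall n, n_positive n phi.

End Positivity.

Definition open_subgroup (H : lcGroupType) (Y : set H) : Prop :=
  [/\ open Y, Y 1%g, forall h k, Y h -> Y k -> Y (h * k)%g &
      forall h, Y h -> Y h^-1%g].

(* Main.v *)
Require Import Defs.
From HB Require Import structures.
From mathcomp Require Import all_boot all_order all_algebra.
From mathcomp Require Import complex.
From mathcomp Require Import all_classical all_reals all_analysis.
From mathcomp Require Import ring.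
Import Order.TTheory GRing.Theory Num.Theory.
Set Implicit Arguments.
Unset Strict Implicit.
Unset Printing Implicit Defensive.
Import numFieldNormedType.Exports.
Local Open Scope classical_set_scope.
Local Open Scope ring_scope.

(** Write b h for alpha h when h lies in Y and for 0 otherwise, so that
    phi (xi *_pi eta) h = <b h xi | eta>.  Everything is a statement about the
    operator-valued function b on H.

    From positivity to a homomorphism.  For points g_1, ..., g_n of H the
    evaluations u |-> u (g_i^-1 g_j) form a positive matrix over W^*(H), so
    4-positivity makes every matrix [b (g_i^-1 g_j)] of size at most 4
    positive.  Size 2 gives b h^-1 = (b h)^* and |<b h y | x>|^2 <=
    <b 1 x | x> <b 1 y | y>; hence Y contains 1 and is closed under inverses.
    Size 3, at the points h^-1, 1, k, gives b (h k) = b h b k as soon as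
    b 1 b k = b k and |b k x|^2 = <b 1 x | x> (lemma pos_family_mul).  These two
    conditions are where the subgroup S is used: characters are contractions, so
    the elements of S act isometrically on the range of the identity e of S,
    and the positive element alpha 1 of S has to be e (positive_group_element).
    Products of values of alpha stay in S, whose elements are nonzero, so Y is
    closed under multiplication.

    Characters are contractions because a coefficient function satisfies
    |u^n| <= (|xi| |eta|)^n in the Fourier-Stieltjes norm: u^n is a coefficient
    of the n-th tensor power of pi.  If f is a bounded character with bound M
    then |f u|^n <= M (|xi| |eta|)^n for all n, whence |f u| <= |xi| |eta|.

    From a homomorphism to complete positivity.  On the range of p the values
    of alpha are unitary, and the functions h |-> <b h xi_j | xi_i> are
    coefficients, for one family of vectors, of the representation of H induced
    from the open subgroup Y.  A positive matrix over W^*(H) is positive on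
    that representation, and this is the positivity that is wanted.

    Tensor powers and induced representations are Hilbert spaces built from
    smaller data.  Both are obtained from a single construction, the
    reproducing kernel Hilbert space of a positive definite kernel k on a set
    X: if a group acts on X and leaves k invariant, it acts unitarily on this
    space of functions by translation, with coefficients k (s x) y.  The kernel
    of the tensor power is <x | y>^n on V; that of the induced representation
    lives on H x I_n. *)

(** * Complex quadratic forms *)

(** The discriminant inequality behind the Cauchy-Schwarz arguments below.  It
    also applies to approximate minimizers, where a is the error allowed. *)
Lemma quadratic_ge0 (C : numClosedFieldType) (a d z : C) : 0 <= a -> 0 <= d ->
  (forall t, 0 <= a + (t * z + (t * z)^*) + t * t^* * d) ->
  `|z| ^+ 2 <= a * d.
Proof.
move=> a0 d0 H; have [->|z0] := eqVneq z 0; first by rewrite normr0 expr0n mulr_ge0.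
have n0 : 0 < `|z| ^+ 2 by rewrite exprn_gt0 // normr_gt0.
have zz : z^* * z = `|z| ^+ 2 by rewrite mulrC -normCK.
(* Along t = - s z^* the form is a - 2 s |z|^2 + s^2 |z|^2 d. *)
have key (s : C) : 0 <= s -> 0 <= a - s * `|z| ^+ 2 *+ 2 + s ^+ 2 * `|z| ^+ 2 * d.
  move=> s0; have := H (- s * z^*).
  have cs : s^* = s by apply/CrealP/ger0_real.
  have -> : (- s * z^*)^* = - s * z by rewrite rmorphM rmorphN /= cs conjCK.
  have -> : (- s * z^* * z)^* = - s * z^* * z.
    rewrite -mulrA zz rmorphM rmorphN /= cs; congr (_ * _).
    by apply/CrealP; rewrite realX // normr_real.
  congr (0 <= _); rewrite -zz; ring.
have [d00|dn0] := eqVneq d 0.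
  (* This s makes the form equal to -1. *)
  have := key ((a + 1) / 2 / `|z| ^+ 2) _.
  have -> : a - (a + 1) / 2 / `|z| ^+ 2 * `|z| ^+ 2 *+ 2 +
      ((a + 1) / 2 / `|z| ^+ 2) ^+ 2 * `|z| ^+ 2 * d = -1.
    by rewrite d00; field; rewrite normr_eq0.
  rewrite oppr_ge0 ler10 => W.
  by exfalso; apply: notF; apply: W; rewrite !divr_ge0 ?addr_ge0 ?ler01 // ?ler0n // ltW.
have := key d^-1; rewrite invr_ge0 => /(_ d0).
have dp : 0 < d by rewrite lt0r dn0.
have -> : a - d^-1 * `|z| ^+ 2 *+ 2 + d^-1 ^+ 2 * `|z| ^+ 2 * d = a - `|z| ^+ 2 / d by field.
by rewrite subr_ge0 ler_pdivrMr.
Qed.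

Lemma add_conj_le (C : numClosedFieldType) (z : C) : z + z^* <= 2 * `|z|.
Proof.
have zr : z + z^* \is Num.real by apply/CrealP; rewrite rmorphD /= conjCK addrC.
apply: le_trans (real_ler_norm zr) _.
by rewrite (le_trans (ler_normD _ _)) // norm_conjC mulr_natl mulr2n.
Qed.

(** * Positive definite kernels and functions bounded for them *)

(** Finite formal combinations of points are lists of pairs (coefficient,
    point): concatenation adds them, over an arbitrary type X. *)
Record pdKernel (R : realType) (X : Type) := PDKernel {
  kernel :> X -> X -> R[i];
  kernel_conj : forall x y, kernel y x = (kernel x y)^*;
  kernel_pos : forall l : seq (R[i] * X),
    0 <= \sum_(p <- l) \sum_(q <- l) p.1 * q.1^* * kernel p.2 q.2 }.

Section Form.
Variables (R : realType) (X : Type) (k : pdKernel R X).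
Local Notation C := R[i].
Local Notation comb := (seq (C * X)).
Implicit Types (l m : comb) (F : X -> C).

Definition kform l m : C :=
  \sum_(p <- l) \sum_(q <- m) p.1 * q.1^* * k p.2 q.2.

Definition comb_scale (c : C) l : comb := [seq (c * p.1, p.2) | p <- l].

(** In the completed space this is the inner product of F with the image of l;
    hence the conjugated coefficients. *)
Definition comb_eval F l : C := \sum_(p <- l) p.1^* * F p.2.

Definition kspan l : X -> C := fun x => \sum_(p <- l) p.1 * k p.2 x.

Lemma kform_ge0 l : 0 <= kform l l. Proof. exact: kernel_pos. Qed.

Lemma kform_conj l m : kform m l = (kform l m)^*.
Proof.
rewrite /kform rmorph_sum exchange_big; apply: eq_bigr => p _ /=.
rewrite rmorph_sum; apply: eq_bigr => q _ /=.
by rewrite !rmorphM /= conjCK -kernel_conj; congr (_ * _); rewrite mulrC.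
Qed.

Lemma kform_catl l l' m : kform (l ++ l') m = kform l m + kform l' m.
Proof. by rewrite /kform big_cat. Qed.

Lemma kform_scalel c l m : kform (comb_scale c l) m = c * kform l m.
Proof.
rewrite /kform big_map mulr_sumr; apply: eq_bigr => p _ /=.
by rewrite mulr_sumr; apply: eq_bigr => q _; rewrite !mulrA.
Qed.

Lemma kform_catr l m m' : kform l (m ++ m') = kform l m + kform l m'.
Proof. by rewrite kform_conj kform_catl rmorphD /= -!kform_conj. Qed.

Lemma kform_scaler c l m : kform l (comb_scale c m) = c^* * kform l m.
Proof. by rewrite kform_conj kform_scalel rmorphM /= -kform_conj. Qed.

Lemma comb_eval_span l m : comb_eval (kspan l) m = kform l m.
Proof.
rewrite /kform exchange_big; apply: eq_bigr => p _ /=.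
by rewrite mulr_sumr; apply: eq_bigr => q _; ring.
Qed.

Lemma comb_eval_cat F l m : comb_eval F (l ++ m) = comb_eval F l + comb_eval F m.
Proof. by rewrite /comb_eval big_cat. Qed.

Lemma comb_eval_scale F c l : comb_eval F (comb_scale c l) = c^* * comb_eval F l.
Proof.
rewrite /comb_eval big_map mulr_sumr; apply: eq_bigr => p _ /=.
by rewrite rmorphM /= mulrA.
Qed.

Lemma comb_eval1 F x : comb_eval F [:: (1, x)] = F x.
Proof. by rewrite /comb_eval big_seq1 rmorph1 mul1r. Qed.

Lemma comb_evalD F G l : comb_eval (fun x => F x + G x) l = comb_eval F l + comb_eval G l.
Proof. by rewrite /comb_eval -big_split; apply: eq_bigr => p _ /=; rewrite mulrDr. Qed.

Lemma comb_evalZ c F l : comb_eval (fun x => c * F x) l = c * comb_eval F l.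
Proof. by rewrite /comb_eval mulr_sumr; apply: eq_bigr => p _ /=; rewrite mulrCA. Qed.

Definition comb_norm l : C := sqrtC (kform l l).

Lemma comb_norm_ge0 l : 0 <= comb_norm l.
Proof. by rewrite sqrtC_ge0 kform_ge0. Qed.

Lemma comb_normK l : comb_norm l ^+ 2 = kform l l.
Proof. exact: sqrtCK. Qed.

(** M bounds the antilinear functional on combinations defined by F.  The
    functions with a finite bound are the elements of the reproducing kernel
    Hilbert space; as it is a space of functions, null combinations are
    identified with 0 from the start. *)
Definition rkhs_bound F (M : R) : Prop :=
  0 <= M /\ forall l, `|comb_eval F l| <= M%:C%C * comb_norm l.

Definition rkhs_pred : {pred X -> C} := fun F => `[< exists M, rkhs_bound F M >].

Lemma rkhs_boundD F G M N :
  rkhs_bound F M -> rkhs_bound G N -> rkhs_bound (fun x => F x + G x) (M + N).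
Proof.
move=> [M0 HM] [N0 HN]; split; first exact: addr_ge0.
move=> l; rewrite comb_evalD rmorphD mulrDl (le_trans (ler_normD _ _)) //.
exact: lerD.
Qed.

Lemma rkhs_boundZ c F M :
  rkhs_bound F M -> rkhs_bound (fun x => c * F x) (complex.Re `|c| * M).
Proof.
have c0 : (complex.Re `|c|)%:C%C = `|c| by rewrite RRe_real // normr_real.
move=> [M0 HM]; split; first by rewrite mulr_ge0 // -ler0c c0.
by move=> l; rewrite comb_evalZ rmorphM /= c0 normrM -mulrA ler_wpM2l.
Qed.

Lemma rkhs_closed : submod_closed (rkhs_pred : {pred X -> C^o}).
Proof.
split.
  apply/asboolP; exists 0; split=> // l.
  by rewrite /comb_eval big1 ?normr0 ?mul0r // => p _; rewrite mulr0.
move=> c F G /asboolP [M HM] /asboolP [N HN]; apply/asboolP.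
by exists (complex.Re `|c| * M + N); apply: rkhs_boundD => //; apply: rkhs_boundZ.
Qed.

End Form.

Record rkhs (R : realType) (X : Type) (k : pdKernel R X) := Rkhs {
  rkhs_fun : X -> R[i]^o; _ : rkhs_fun \in rkhs_pred k }.

HB.instance Definition _ R X (k : pdKernel R X) :=
  [isSub for @rkhs_fun R X k].
HB.instance Definition _ R X (k : pdKernel R X) :=
  [Choice of rkhs k by <:].
HB.instance Definition _ R X (k : pdKernel R X) :=
  GRing.isSubmodClosed.Build R[i] (X -> R[i]^o) (@rkhs_pred R X k) (rkhs_closed k).
HB.instance Definition _ R X (k : pdKernel R X) :=
  [SubChoice_isSubLmodule of rkhs k by <:].

(** * The norm of the reproducing kernel Hilbert space *)

Section Norm.
Variables (R : realType) (X : Type) (k : pdKernel R X).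
Local Notation C := R[i].
Local Notation comb := (seq (C * X)).
Implicit Types (l m : comb) (F G : rkhs k).

Let RtoC (z : C) : z \is Num.real -> (complex.Re z)%:C%C = z.
Proof. exact: RRe_real. Qed.

Lemma Re_norm (z : C) : (complex.Re `|z|)%:C%C = `|z|.
Proof. by rewrite RtoC // normr_real. Qed.

Definition rkhs_norm F : R := inf [set M | rkhs_bound k (\val F) M].

Lemma rkhs_bounds_has_inf F : has_inf [set M | rkhs_bound k (\val F) M].
Proof.
by split; [case/asboolP: (valP F) => M HM; exists M | exists 0 => M []].
Qed.

Lemma rkhs_norm_ge0 F : 0 <= rkhs_norm F.
Proof. by apply: lb_le_inf; [case: (rkhs_bounds_has_inf F) | move=> M []]. Qed.

(** The infimum of the bounds is itself a bound.  If the combination has norm 0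
    any bound shows that F vanishes on it. *)
Lemma rkhs_norm_eval F l :
  `|comb_eval (\val F) l| <= (rkhs_norm F)%:C%C * comb_norm k l.
Proof.
have := comb_norm_ge0 k l; rewrite le0r => /orP[/eqP E|l0].
  by case/asboolP: (valP F) => M [_ /(_ l)]; rewrite E !mulr0.
rewrite -ler_pdivrMr //; set z := _ / _.
have zr : z \is Num.real by rewrite ger0_real // divr_ge0 // ltW.
rewrite -(RtoC zr) lecR; apply: lb_le_inf; first by case: (rkhs_bounds_has_inf F).
by move=> M [_ HM]; rewrite -lecR (RtoC zr) ler_pdivrMr.
Qed.

Lemma rkhs_norm_le F (M : R) : rkhs_bound k (\val F) M -> rkhs_norm F <= M.
Proof. by move=> HM; apply: ge_inf => //; exists 0 => N []. Qed.

Lemma rkhs_normD F G : (rkhs_norm (F + G))%:C%C <= (rkhs_norm F)%:C%C + (rkhs_norm G)%:C%C.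
Proof.
rewrite -rmorphD lecR; apply: rkhs_norm_le.
by apply: rkhs_boundD; split; rewrite ?rkhs_norm_ge0 //; apply: rkhs_norm_eval.
Qed.

Lemma rkhs_normZ_le (c : C) F : (rkhs_norm (c *: F))%:C%C <= `|c| * (rkhs_norm F)%:C%C.
Proof.
rewrite -Re_norm -rmorphM lecR; apply: rkhs_norm_le; rewrite linearZ.
by apply: rkhs_boundZ; split; rewrite ?rkhs_norm_ge0 //; apply: rkhs_norm_eval.
Qed.

Lemma rkhs_normZ (c : C) F : (rkhs_norm (c *: F))%:C%C = `|c| * (rkhs_norm F)%:C%C.
Proof.
apply/eqP; rewrite eq_le rkhs_normZ_le /=.
have [->|c0] := eqVneq c 0; first by rewrite normr0 mul0r ler0c rkhs_norm_ge0.
rewrite mulrC -ler_pdivlMr ?normr_gt0 // mulrC -normfV.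
by rewrite -{1}[F](scalerK c0) rkhs_normZ_le.
Qed.

Lemma rkhs_norm0_eq0 F : (rkhs_norm F)%:C%C = 0 -> F = 0.
Proof.
move=> F0; apply/val_inj/funext => x /=.
have := rkhs_norm_eval F [:: (1, x)].
by rewrite F0 mul0r comb_eval1 normr_le0 => /eqP.
Qed.

HB.instance Definition _ := Lmodule_isNormed.Build C (rkhs k)
  rkhs_normD rkhs_normZ rkhs_norm0_eq0.

Lemma rkhs_norm_leC F (M : R) : 0 <= M ->
  (forall l, `|comb_eval (\val F) l| <= M%:C%C * comb_norm k l) -> `|F| <= M%:C%C.
Proof. by move=> M0 HM; rewrite lecR; apply: rkhs_norm_le. Qed.

Lemma kform_expand l m (t : C) :
  kform k (l ++ comb_scale t m) (l ++ comb_scale t m) =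
  kform k l l + (t * kform k m l + (t * kform k m l)^*) + t * t^* * kform k m m.
Proof.
rewrite kform_catl !kform_catr !kform_scalel !kform_scaler.
by rewrite rmorphM /= -kform_conj; ring.
Qed.

Lemma kform_cauchy_schwarz l m : `|kform k l m| <= comb_norm k l * comb_norm k m.
Proof.
rewrite -(@ler_pXn2r _ 2) ?nnegrE ?mulr_ge0 ?comb_norm_ge0 //.
rewrite exprMn !comb_normK kform_conj norm_conjC.
by apply: quadratic_ge0; rewrite ?kform_ge0 // => t; rewrite -kform_expand kform_ge0.
Qed.

Lemma kspan_rkhs l : (kspan k l : X -> C^o) \in rkhs_pred k.
Proof.
apply/asboolP; exists (complex.Re (comb_norm k l)).
have E : (complex.Re (comb_norm k l))%:C%C = comb_norm k l.
  by apply/RtoC/ger0_real/comb_norm_ge0.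
split; first by rewrite -ler0c E comb_norm_ge0.
by move=> m; rewrite comb_eval_span E kform_cauchy_schwarz.
Qed.

Definition rkhs_span l : rkhs k := Rkhs (kspan_rkhs l).

Lemma rkhs_span_cat l m : rkhs_span (l ++ m) = rkhs_span l + rkhs_span m.
Proof. by apply/val_inj/funext => x /=; rewrite /kspan big_cat. Qed.

Lemma rkhs_span_scale c l : rkhs_span (comb_scale c l) = c *: rkhs_span l.
Proof.
apply/val_inj/funext => x /=; rewrite /kspan big_map [RHS]mulr_sumr.
by apply: eq_bigr => p _; rewrite mulrA.
Qed.

Lemma norm_rkhs_span l : `|rkhs_span l| = comb_norm k l.
Proof.
have E : (complex.Re (comb_norm k l))%:C%C = comb_norm k l.
  by apply/RtoC/ger0_real/comb_norm_ge0.
apply/eqP; rewrite eq_le; apply/andP; split.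
  rewrite -E; apply: rkhs_norm_leC; first by rewrite -ler0c E comb_norm_ge0.
  by move=> m; rewrite comb_eval_span E kform_cauchy_schwarz.
have := comb_norm_ge0 k l; rewrite le0r => /orP[/eqP ->|l0].
  by rewrite normr_ge0.
rewrite -(ler_pM2r l0) -expr2 comb_normK -comb_eval_span.
apply: le_trans (rkhs_norm_eval (rkhs_span l) l).
by rewrite comb_eval_span ger0_norm // kform_ge0.
Qed.

(** The combination l is chosen to minimize, up to e^2, the functional
    J l = |F - l|^2 - |F|^2, which makes sense before an inner product is
    available.  Near-minimality along all lines l + t m then bounds F - l by
    the discriminant inequality. *)
Lemma rkhs_span_dense F (e : R) : 0 < e -> exists l, `|F - rkhs_span l| <= e%:C%C.
Proof.
move=> e0.
pose J l : C := kform k l l - (comb_eval (\val F) l + (comb_eval (\val F) l)^*).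
have Jr l : (complex.Re (J l))%:C%C = J l.
  apply: RtoC; apply: rpredB; first by rewrite ger0_real ?kform_ge0.
  by apply/CrealP; rewrite rmorphD /= conjCK addrC.
(* Completing the square: J l + |F|^2 >= (|l| - |F|)^2. *)
have hJ : has_inf [set complex.Re (J l) | l in setT].
  split; first by exists (complex.Re (J [::])), [::].
  exists (- (rkhs_norm F) ^+ 2) => _ [l _ <-].
  rewrite -lecR Jr rmorphN rmorphXn /=.
  have := rkhs_norm_eval F l; set n := (rkhs_norm F)%:C%C; set z := comb_eval _ _.
  move=> zn; rewrite /J -comb_normK -/z.
  have nr : n \is Num.real by rewrite ger0_real // ler0c rkhs_norm_ge0.
  have ln : comb_norm k l \is Num.real by rewrite ger0_real // comb_norm_ge0.
  have zz : z + z^* <= 2 * (n * comb_norm k l).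
    apply: le_trans (_ : 2 * `|z| <= _); last by rewrite ler_pM2l ?ltr0n.
    exact: add_conj_le.
  have sq : 0 <= (comb_norm k l - n) ^+ 2 by rewrite real_exprn_even_ge0 ?rpredB.
  rewrite -subr_ge0; apply: le_trans sq _; rewrite -subr_ge0.
  by move: zz; rewrite -subr_ge0; congr (0 <= _); ring.
have [_ [l _ <-] Hl] := inf_adherent (exprn_gt0 2 e0) hJ.
exists l; rewrite distrC; apply: rkhs_norm_leC; first exact: ltW.
move=> m; rewrite -(@ler_pXn2r _ 2) ?nnegrE ?normr_ge0 ?mulr_ge0 ?comb_norm_ge0 ?ler0c ?(ltW e0) //.
rewrite exprMn comb_normK.
have -> : comb_eval (\val (rkhs_span l - F)) m = kform k l m - comb_eval (\val F) m.
  rewrite -comb_eval_span /comb_eval -sumrB; apply: eq_bigr => p _ /=.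
  by rewrite -mulrBr.
rewrite -norm_conjC; apply: quadratic_ge0.
- by rewrite -rmorphXn ler0c exprn_ge0 // ltW.
- exact: kform_ge0.
move=> t.
have : complex.Re (J l) <= complex.Re (J (l ++ comb_scale t m)) + e ^+ 2.
  rewrite -lerBlDr; apply: le_trans (_ : inf [set complex.Re (J l) | l in setT] <= _).
    by rewrite lerBlDr ltW.
  by apply: ge_inf; [case: hJ | exists (l ++ comb_scale t m)].
rewrite -lecR rmorphD /= !Jr -subr_ge0 rmorphXn /=; congr (0 <= _).
rewrite /J kform_expand comb_eval_cat comb_eval_scale.
rewrite !(rmorphM, rmorphB, rmorphD) /= ?(rmorphB, rmorphM) /= !conjCK -!kform_conj.
by ring.
Qed.

End Norm.

(** * Completeness of the complex numbers *)

Section Complete.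
Variable R : realType.
Local Notation C := R[i].

Lemma normc_real (x : R) : `|x%:C%C| = `|x|%:C%C.
Proof. by rewrite normc_def /= expr0n /= addr0 sqrtr_sqr. Qed.

Lemma normc_le_Re_Im (z : C) : `|z| <= `|complex.Re z|%:C%C + `|complex.Im z|%:C%C.
Proof.
rewrite {1}[z]complexE (le_trans (ler_normD _ _)) // normrM !normc_real.
by rewrite [`|'i%C|]normc_def /= expr0n expr1n add0r sqrtr1 mul1r.
Qed.

Lemma normc_ge_Im (z : C) : `|complex.Im z|%:C%C <= `|z|.
Proof. by rewrite normc_def lecR -sqrtr_sqr ler_sqrt ?lerDr ?addr_ge0 ?sqr_ge0. Qed.

Lemma complex_gt0_real (e : C) : 0 < e -> exists2 r : R, 0 < r & e = r%:C%C.
Proof.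
move=> e0; have er : (complex.Re e)%:C%C = e by rewrite RRe_real // gtr0_real.
by exists (complex.Re e); rewrite ?er // -ltcR er.
Qed.

Lemma complex_complete (F : set_system C^o) : ProperFilter F -> cauchy F ->
  exists z : C^o, F --> z.
Proof.
move=> FF /cauchyP cF.
have cpart (f : C -> R) : (forall x y, `|f x - f y|%:C%C <= `|x - y|) ->
    exists a : R, f x @[x --> F] --> a.
  move=> fl; exists (lim (f x @[x --> F])); apply: cauchy_cvg.
  apply: cauchy_exP => e e0; have [|x Fx] := cF e%:C%C; first by rewrite ltcR.
  exists (f x); change (F (f @^-1` ball (f x) e)).
  apply: filterS Fx => y; rewrite -!ball_normE /= => xy.
  by rewrite -ltcR (le_lt_trans (fl _ _)).
have [|a Fa] := cpart (@complex.Re R).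
  by move=> x y; rewrite -(raddfB (@complex.Re R : Rcomplex R -> R)) normc_ge_Re.
have [|b Fb] := cpart (@complex.Im R).
  by move=> x y; rewrite -(raddfB (@complex.Im R : Rcomplex R -> R)) normc_ge_Im.
exists (Complex a b); apply/cvgrPdist_le => _ /complex_gt0_real [e e0 ->].
have e2 : 0 < e / 2 by rewrite divr_gt0.
near=> z; rewrite (le_trans (normc_le_Re_Im _)) // -rmorphD lecR [leRHS]splitr lerD //.
- near: z; apply: filterS (cvgr_dist_le _ _ Fa _ e2) => z; case: z => //.
- near: z; apply: filterS (cvgr_dist_le _ _ Fb _ e2) => z; case: z => //.
Unshelve. all: by end_near. Qed.
End Complete.

(** * Completeness and inner product *)

Section Hilbert.
Variables (R : realType) (X : Type) (k : pdKernel R X).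
Local Notation C := R[i].
Local Notation comb := (seq (C * X)).
Implicit Types (l m : comb) (F G : rkhs k).

Lemma norm_comb_evalB F G l :
  `|comb_eval (\val F) l - comb_eval (\val G) l| <= `|F - G| * comb_norm k l.
Proof.
suff -> : comb_eval (\val F) l - comb_eval (\val G) l = comb_eval (\val (F - G)) l.
  exact: rkhs_norm_eval.
by rewrite /comb_eval -sumrB; apply: eq_bigr => p _; rewrite -mulrBr.
Qed.

(** The evaluations at combinations are Lipschitz, so a Cauchy filter converges
    pointwise; the bounds survive the limit. *)
Lemma rkhs_complete (Fi : set_system (rkhs k)) : ProperFilter Fi -> cauchy Fi -> cvg Fi.
Proof.
move=> PF /cauchyP cF.
have cev l : exists z : C^o, (fun G => comb_eval (\val G) l) x @[x --> Fi] --> z.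
  apply: complex_complete; apply/cauchyP => _ /complex_gt0_real [e e0 ->].
  have [r r0 Er] : exists2 r : R, 0 < r & r%:C%C * comb_norm k l <= e%:C%C.
    have l1 : 0 < comb_norm k l + 1 by rewrite ltr_wpDl ?ltr01 ?comb_norm_ge0.
    have [s s0 Es] := complex_gt0_real l1; exists (e / s); first exact: divr_gt0.
    rewrite rmorphM fmorphV /= -Es mulrAC ler_pdivrMr // ler_wpM2l ?ler0c ?(ltW e0) //.
    by rewrite lerDl ler01.
  have [|G FG] := cF r%:C%C; first by rewrite ltcR.
  exists (comb_eval (\val G) l).
  change (Fi ((fun G => comb_eval (\val G) l : C^o) @^-1`
    ball (comb_eval (\val G) l : C^o) e%:C%C)).
  apply: filterS FG => H; rewrite -!ball_normE /= => GH.
  have [E0|l0] := eqVneq (comb_norm k l) 0.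
    have := norm_comb_evalB G H l; rewrite E0 mulr0 => /le_lt_trans; apply.
    by rewrite ltcR.
  apply: le_lt_trans (norm_comb_evalB G H l) _; apply: lt_le_trans Er.
  by rewrite ltr_pM2r // lt0r l0 comb_norm_ge0.
pose ev x := projT1 (cid (cev [:: (1, x)])).
have evP l : (fun G => comb_eval (\val G) l : C^o) x @[x --> Fi] --> (comb_eval ev l : C^o).
  rewrite /comb_eval; apply: cvg_big => [|p _]; first exact: add_continuous.
  apply: cvgMl_tmp; have := projT2 (cid (cev [:: (1, p.2)])); rewrite -/(ev p.2).
  by under eq_cvg do rewrite comb_eval1.
have close (e : R) : 0 < e -> exists2 G, Fi (ball G e%:C%C) &
    forall l, `|comb_eval ev l - comb_eval (\val G) l| <= e%:C%C * comb_norm k l.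
  move=> e0; have [|G FG] := cF e%:C%C; first by rewrite ltcR.
  exists G => // l.
  apply/ler_addgt0Pr => r r0.
  have FH : \forall H \near Fi, `|comb_eval ev l - comb_eval (\val H) l| <= r.
    exact: cvgr_dist_le (evP l) _ r0.
  have [H [GH Hr]] := filter_ex (filterI FG FH).
  rewrite -(subrK (comb_eval (\val H) l) (comb_eval ev l)) -addrA addrC.
  rewrite (le_trans (ler_normD _ _)) // lerD //.
  rewrite (le_trans (norm_comb_evalB H G l)) // ler_wpM2r ?comb_norm_ge0 //.
  by move: GH; rewrite -ball_normE /= distrC => /ltW.
have evb : (ev : X -> C^o) \in rkhs_pred k.
  have [G _ HG] := close 1 ltr01; apply/asboolP; exists (rkhs_norm G + 1); split.
    by rewrite addr_ge0 ?rkhs_norm_ge0.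
  move=> l; rewrite -(subrK (comb_eval (\val G) l) (comb_eval ev l)) rmorphD mulrDl addrC.
  by rewrite (le_trans (ler_normD _ _)) // lerD ?HG // rkhs_norm_eval.
apply/cvg_ex; exists (Rkhs evb); apply/cvgrPdist_le => _ /complex_gt0_real [e e0 ->].
have e2 : 0 < e / 2 by rewrite divr_gt0.
have [G FG HG] := close _ e2; apply: filterS FG => H; rewrite -ball_normE /= => GH.
rewrite -[Rkhs evb](subrK G) -addrA (le_trans (ler_normD _ _)) //.
rewrite [e]splitr rmorphD lerD //; last exact: ltW.
apply: rkhs_norm_leC; first exact: ltW.
move=> l; apply: le_trans (HG l); rewrite le_eqVlt; apply/orP; left; apply/eqP; congr `|_|.
by rewrite /comb_eval -sumrB; apply: eq_bigr => p _; rewrite -mulrBr.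
Qed.

HB.instance Definition _ := Uniform_isComplete.Build (rkhs k) rkhs_complete.

Lemma cvgC_unique (u : nat -> C^o) (a b : C^o) :
  u n @[n --> \oo] --> a -> u n @[n --> \oo] --> b -> a = b.
Proof. exact: (cvg_unique (@norm_hausdorff _ C^o)). Qed.

(** The inner product is defined from the norm by polarization.  This makes it
    continuous at once, and as it agrees with the form of the kernel on finite
    combinations, its algebraic properties follow by density. *)
Definition rkhs_inner F G : C :=
  4^-1 * (`|F + G| ^+ 2 - `|F - G| ^+ 2
          + 'i * (`|F + 'i *: G| ^+ 2 - `|F - 'i *: G| ^+ 2)).

Lemma rkhs_inner_span l m : rkhs_inner (rkhs_span k l) (rkhs_span k m) = kform k l m.
Proof.
have E t : `|rkhs_span k l + t *: rkhs_span k m| ^+ 2 =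
    kform k l l + (t * kform k m l + (t * kform k m l)^*) + t * t^* * kform k m m.
  by rewrite -rkhs_span_scale -rkhs_span_cat norm_rkhs_span comb_normK kform_expand.
have E1 := E 1; have EN1 := E (-1); have Ei := E 'i; have ENi := E (- 'i).
rewrite scale1r in E1; rewrite scaleN1r in EN1; rewrite scaleNr in ENi.
rewrite /rkhs_inner E1 EN1 Ei ENi !rmorphM /= -!kform_conj !rmorphN rmorph1 /= conjCi.
have : ('i : C) ^+ 2 = -1 := sqrCi _.
move: ('i : C) => j jj.
transitivity (2^-1 * (kform k m l + kform k l m - j ^+ 2 * (kform k l m - kform k m l))).
  by field.
by rewrite jj; field.
Qed.

Lemma rkhs_approx F : exists L : nat -> comb, rkhs_span k (L n) @[n --> \oo] --> F.
Proof.
have H n : exists l, `|F - rkhs_span k l| <= (n.+1%:R^-1 : R)%:C%C.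
  by apply: rkhs_span_dense; rewrite invr_gt0 ltr0n.
exists (fun n => projT1 (cid (H n))); apply/cvgrPdist_le => _ /complex_gt0_real [e e0 ->].
near=> n; apply: le_trans (projT2 (cid (H n))) _; rewrite lecR.
near: n; have := @cvg_harmonic R.
by move=> /cvgrPdist_le /(_ e e0); apply: filterS => n; rewrite sub0r normrN ger0_norm // invr_ge0.
Unshelve. all: by end_near. Qed.

Lemma cvg_rkhs_inner (f g : nat -> rkhs k) F G : f n @[n --> \oo] --> F ->
  g n @[n --> \oo] --> G -> (rkhs_inner (f n) (g n) : C^o) @[n --> \oo] --> (rkhs_inner F G : C^o).
Proof.
move=> fF gG.
have sq (h : nat -> rkhs k) H : h n @[n --> \oo] --> H ->
    (`|h n| ^+ 2 : C^o) @[n --> \oo] --> (`|H| ^+ 2 : C^o).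
  by move=> hH; rewrite !expr2; apply: cvgM; apply: cvg_norm.
have iG : 'i *: g n @[n --> \oo] --> 'i *: G by apply: cvgZl_tmp.
rewrite /rkhs_inner; apply: cvgMl_tmp; apply: cvgD; last apply: cvgMl_tmp.
  by apply: (cvgB (sq (f \+ g) _ _) (sq (f \- g) _ _)); [apply: cvgD | apply: cvgB].
by apply: (cvgB (sq (fun n => f n + 'i *: g n) _ _) (sq (fun n => f n - 'i *: g n) _ _));
  [apply: cvgD | apply: cvgB].
Qed.

Lemma rkhs_inner_linear G : linear_for *%R (rkhs_inner^~ G).
Proof.
move=> c F F'; have [L LF] := rkhs_approx F; have [L' LF'] := rkhs_approx F'.
have [M MG] := rkhs_approx G.
have h1 : (rkhs_inner (c *: rkhs_span k (L n) + rkhs_span k (L' n)) (rkhs_span k (M n)) : C^o)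
    @[n --> \oo] --> (rkhs_inner (c *: F + F') G : C^o).
  by apply: cvg_rkhs_inner => //; apply: cvgD => //; apply: cvgZl_tmp.
apply: (cvgC_unique h1).
have E n : rkhs_inner (c *: rkhs_span k (L n) + rkhs_span k (L' n)) (rkhs_span k (M n)) =
    c * rkhs_inner (rkhs_span k (L n)) (rkhs_span k (M n))
    + rkhs_inner (rkhs_span k (L' n)) (rkhs_span k (M n)).
  by rewrite -rkhs_span_scale -rkhs_span_cat !rkhs_inner_span kform_catl kform_scalel.
under eq_cvg do rewrite E.
by apply: cvgD; [apply: cvgMl_tmp |]; apply: cvg_rkhs_inner.
Qed.

Lemma rkhs_inner_norm F : rkhs_inner F F = `|F| ^+ 2.
Proof.
have [L LF] := rkhs_approx F; apply: (cvgC_unique (cvg_rkhs_inner LF LF)).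
have E n : rkhs_inner (rkhs_span k (L n)) (rkhs_span k (L n)) =
    `|rkhs_span k (L n)| * `|rkhs_span k (L n)|.
  by rewrite rkhs_inner_span -comb_normK -norm_rkhs_span expr2.
under eq_cvg do rewrite E.
by rewrite expr2; apply: cvgM; apply: cvg_norm.
Qed.

Lemma rkhs_inner_conj F G : rkhs_inner G F = (rkhs_inner F G)^*.
Proof.
have nr (H : rkhs k) : (`|H| ^+ 2)^* = `|H| ^+ 2 :> C.
  by apply/CrealP; rewrite realX // ger0_real.
have ni (c : C) (H : rkhs k) : `|c| = 1 -> `|c *: H| = `|H| by move=> c1; rewrite normrZ c1 mul1r.
have e3 : `|G + 'i *: F| = `|F - 'i *: G|.
  rewrite -(ni 'i (F - _)) ?normCi // scalerBr scalerA -expr2 sqrCi.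
  by rewrite scaleN1r opprK addrC.
have e4 : `|G - 'i *: F| = `|F + 'i *: G|.
  rewrite -(ni (- 'i) (F + _)) ?normrN ?normCi // scalerDr scalerA mulNr -expr2 sqrCi.
  by rewrite opprK scale1r scaleNr addrC.
rewrite /rkhs_inner e3 e4 [G + F]addrC (distrC G).
rewrite rmorphM rmorphD !rmorphB rmorphM rmorphB /= conjCi !nr fmorphV rmorph_nat.
by rewrite mulNr -mulrN opprB.
Qed.

HB.instance Definition _ := isHilbert.Build R (rkhs k)
  rkhs_inner_linear rkhs_inner_conj rkhs_inner_norm.

End Hilbert.

(** * Inner products and operators *)

(** Polarization comes down to this separation of a semilinear from a linear
    part, tested at t = 1 and t = i. *)
Lemma semilinear_coef_eq (C : numClosedFieldType) (a b a' b' : C) :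
  (forall t, t^* * a + t * b = t^* * a' + t * b') -> a = a'.
Proof.
move=> D; have D1 := D 1; have Di := D 'i.
rewrite rmorph1 !mul1r in D1; rewrite conjCi in Di.
have {}Di : a - b = a' - b'.
  apply: (mulfI (neq0Ci C)); rewrite !mulrBr; apply: oppr_inj.
  by apply: etrans (etrans Di _); ring.
apply: (mulfI (_ : 2 != 0)); first by rewrite pnatr_eq0.
by transitivity ((a + b) + (a - b)); [ring | rewrite D1 Di; ring].
Qed.

Section InnerTheory.
Variables (R : realType) (V : hilbertType R).
Local Notation C := R[i].
Implicit Types x y z : V.

Lemma innerDl x y z : inner (x + y) z = inner x z + inner y z.
Proof. by have := inner_linear z 1 x y; rewrite scale1r mul1r. Qed.

Lemma inner0l z : inner 0 z = 0 :> C.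
Proof. by have := inner_linear z (-1) 0 0; rewrite scaler0 addr0 mulN1r addNr. Qed.

Lemma innerZl (c : C) x z : inner (c *: x) z = c * inner x z.
Proof. by have := inner_linear z c x 0; rewrite addr0 inner0l addr0. Qed.

Lemma innerNl x z : inner (- x) z = - inner x z.
Proof. by rewrite -scaleN1r innerZl mulN1r. Qed.

Lemma innerBl x y z : inner (x - y) z = inner x z - inner y z.
Proof. by rewrite innerDl innerNl. Qed.

Lemma innerDr x y z : inner z (x + y) = inner z x + inner z y.
Proof. by rewrite inner_conj innerDl rmorphD /= -!inner_conj. Qed.

Lemma innerZr (c : C) x z : inner z (c *: x) = c^* * inner z x.
Proof. by rewrite inner_conj innerZl rmorphM /= -inner_conj. Qed.

Lemma inner0r z : inner z 0 = 0 :> C.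
Proof. by rewrite inner_conj inner0l rmorph0. Qed.

Lemma innerNr x z : inner z (- x) = - inner z x.
Proof. by rewrite inner_conj innerNl rmorphN /= -inner_conj. Qed.

Lemma innerBr x y z : inner z (x - y) = inner z x - inner z y.
Proof. by rewrite innerDr innerNr. Qed.

Lemma inner_ge0 x : 0 <= inner x x :> C.
Proof. by rewrite inner_norm exprn_ge0. Qed.

Lemma inner_suml I (r : seq I) (P : pred I) (F : I -> V) z :
  inner (\sum_(i <- r | P i) F i) z = \sum_(i <- r | P i) inner (F i) z.
Proof. by elim/big_rec2 : _ => [|i a b _ <-]; rewrite ?inner0l ?innerDl. Qed.

Lemma inner_sumr I (r : seq I) (P : pred I) (F : I -> V) z :
  inner z (\sum_(i <- r | P i) F i) = \sum_(i <- r | P i) inner z (F i).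
Proof. by elim/big_rec2 : _ => [|i a b _ <-]; rewrite ?inner0r ?innerDr. Qed.

Lemma inner_cauchy_schwarz x y : `|inner x y| <= `|x| * `|y| :> C.
Proof.
rewrite -(@ler_pXn2r _ 2) ?nnegrE ?mulr_ge0 //.
rewrite exprMn -!inner_norm inner_conj norm_conjC.
apply: quadratic_ge0; rewrite ?inner_ge0 // => t.
have := inner_ge0 (x + t *: y).
by rewrite innerDl !innerDr !innerZl !innerZr rmorphM /= -inner_conj; congr (0 <= _); ring.
Qed.

Lemma inner_inj x y : (forall z, inner x z = inner y z) -> x = y.
Proof.
move=> E; apply/eqP; rewrite -subr_eq0 -normr_eq0.
have : `|x - y| ^+ 2 == 0 :> C by rewrite -inner_norm innerBl E subrr.
by rewrite expf_eq0.
Qed.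

Lemma norm_subr_sqr x y : `|x - y| ^+ 2 =
  `|x| ^+ 2 + `|y| ^+ 2 - (inner x y + (inner x y)^*) :> C.
Proof. by rewrite -!inner_norm innerBl !innerBr -inner_conj; ring. Qed.

Lemma linear_polarization (T S : V -> V) : linear T -> linear S ->
  (forall x, inner (T x) x = inner (S x) x) -> T = S.
Proof.
move=> lT lS E; apply/funext => x; apply: inner_inj => y.
apply: (@semilinear_coef_eq C _ (inner (T y) x) _ (inner (S y) x)) => t.
have := E (t *: y + x); rewrite (lT t y x) (lS t y x) !innerDl !innerDr !innerZl !innerZr.
rewrite !E => H; apply: (addrI (t * (t^* * inner (S y) y) + inner (S x) x)).
by apply: etrans (etrans H _); ring.
Qed.

Lemma isometry_inner (T : V -> V) : linear T -> (forall x, `|T x| = `|x|) ->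
  forall x y, inner (T x) (T y) = inner x y.
Proof.
move=> lT nT x y.
apply: (@semilinear_coef_eq C _ (inner (T y) (T x)) _ (inner y x)) => t.
have := congr1 (fun c => c ^+ 2) (nT (t *: y + x)); rewrite (lT t y x) -!inner_norm.
rewrite !innerDl !innerDr !innerZl !innerZr !inner_norm !nT => H.
apply: (addrI (t * (t^* * `|y| ^+ 2) + `|x| ^+ 2)).
by apply: etrans (etrans H _); ring.
Qed.

Lemma cvg_innerl (T : Type) (F : set_system T) (FF : Filter F) (f : T -> V) x y :
  f s @[s --> F] --> x -> (inner (f s) y : C^o) @[s --> F] --> (inner x y : C^o).
Proof.
move=> fx; apply/cvgrPdist_le => e e0.
have y1 : 0 < `|y| + 1 :> C by rewrite ltr_wpDl.
have ey : 0 < e / (`|y| + 1) by rewrite divr_gt0.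
have : \forall s \near F, `|x - f s| <= e / (`|y| + 1) by exact: cvgr_dist_le fx _ ey.
apply: filterS => s H.
rewrite -innerBl (le_trans (inner_cauchy_schwarz _ _)) //.
rewrite (le_trans (ler_wpM2r (normr_ge0 y) H)) // mulrAC ler_pdivrMr // ler_wpM2l ?(ltW e0) //.
by rewrite lerDl ler01.
Qed.

End InnerTheory.

(** * The unitary representation of an invariant kernel *)
Section KernelRep.
Variables (R : realType) (G : lcGroupType) (X : Type) (k : pdKernel R X).
Variable act : G -> X -> X.
Hypothesis act1 : forall x, act 1%g x = x.
Hypothesis actM : forall s t x, act (s * t)%g x = act s (act t x).
Hypothesis k_inv : forall s x y, k (act s x) (act s y) = k x y.
Hypothesis k_cts : forall x y, continuous (fun s => k (act s x) y : R[i]^o).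
Local Notation C := R[i].
Implicit Types (l m : seq (C * X)) (F : rkhs k) (s t : G).

Definition comb_act s l := [seq (p.1, act s p.2) | p <- l].

Lemma kform_act s l m : kform k (comb_act s l) (comb_act s m) = kform k l m.
Proof.
rewrite /kform big_map; apply: eq_bigr => p _; rewrite big_map.
by apply: eq_bigr => q _; rewrite k_inv.
Qed.

Lemma comb_norm_act s l : comb_norm k (comb_act s l) = comb_norm k l.
Proof. by rewrite /comb_norm kform_act. Qed.

Lemma comb_eval_act s (F : X -> C) l :
  comb_eval (F \o act s) l = comb_eval F (comb_act s l).
Proof. by rewrite /comb_eval big_map. Qed.

Lemma rkhs_act_pred s F : (\val F \o act s^-1%g : X -> C^o) \in rkhs_pred k.
Proof.
apply/asboolP; case/asboolP: (valP F) => M [M0 HM]; exists M; split => // l.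
by rewrite comb_eval_act -(comb_norm_act s^-1%g) HM.
Qed.

(** Since elements are functions, the group acts by translation of the variable
    and the action laws hold by computation. *)
Definition rkhs_act s F : rkhs k := Rkhs (rkhs_act_pred s F).

Lemma rkhs_act_linear s : linear (rkhs_act s).
Proof. by move=> c F F'; apply/val_inj/funext. Qed.

Lemma rkhs_act1 : rkhs_act 1%g = id.
Proof. by apply/funext => F; apply/val_inj/funext => x /=; rewrite invg1 act1. Qed.

Lemma rkhs_actM s t : rkhs_act (s * t)%g = rkhs_act s \o rkhs_act t.
Proof. by apply/funext => F; apply/val_inj/funext => x /=; rewrite invgM actM. Qed.

Lemma norm_rkhs_act_le s F : `|rkhs_act s F| <= `|F|.
Proof.
apply: rkhs_norm_leC; first exact: rkhs_norm_ge0.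
by move=> l; rewrite comb_eval_act -(comb_norm_act s^-1%g) rkhs_norm_eval.
Qed.

Lemma norm_rkhs_act s F : `|rkhs_act s F| = `|F|.
Proof.
apply/eqP; rewrite eq_le norm_rkhs_act_le /=.
have {1}-> : F = rkhs_act s^-1%g (rkhs_act s F).
  by rewrite -[RHS]/((rkhs_act _ \o rkhs_act _) F) -rkhs_actM mulVg rkhs_act1.
exact: norm_rkhs_act_le.
Qed.

Lemma inner_rkhs_act s F F' : inner (rkhs_act s F) (rkhs_act s F') = inner F F'.
Proof. exact: (isometry_inner (rkhs_act_linear s) (norm_rkhs_act s)). Qed.

Lemma rkhs_act_span s l : rkhs_act s (rkhs_span k l) = rkhs_span k (comb_act s l).
Proof.
apply/val_inj/funext => x /=; rewrite /kspan big_map; apply: eq_bigr => p _ /=.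
by rewrite -(k_inv s) -actM mulgV act1.
Qed.


Definition rkhs_vec x : rkhs k := rkhs_span k [:: (1, x)].

Lemma inner_rkhs_vec x y : inner (rkhs_vec x) (rkhs_vec y) = k x y.
Proof. by rewrite [LHS]rkhs_inner_span /kform !big_seq1 /= rmorph1 !mul1r. Qed.

Lemma rkhs_act_vec s x : rkhs_act s (rkhs_vec x) = rkhs_vec (act s x).
Proof. exact: rkhs_act_span. Qed.

(** By invariance |s v_x - t v_x|^2 = 2 Re (k x x - k (t x) (s x)), so strong
    continuity comes down to continuity of the kernel along orbits. *)
Lemma rkhs_act_vec_cts x : continuous (fun s => rkhs_act s (rkhs_vec x)).
Proof.
move=> s; apply/cvgrPdist_le => e e0.
have e2 : 0 < e ^+ 2 / 2 by rewrite divr_gt0 // exprn_gt0.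
have := @k_cts x (act s x) s => /cvgrPdist_le /(_ _ e2).
apply: filterS => t H; rewrite -(@ler_pXn2r _ 2) ?nnegrE ?(ltW e0) //.
rewrite norm_subr_sqr -!inner_norm !rkhs_act_vec !inner_rkhs_vec.
rewrite !k_inv; rewrite k_inv in H; set a := k x x in H *.
set b := k (act t x) (act s x) in H *.
rewrite [k (act s x) (act t x)]kernel_conj -/b conjCK.
have ar : a^* = a by rewrite /a -kernel_conj.
have -> : a + a - (b^* + b) = (a - b) + (a - b)^* by rewrite rmorphB /= ar; ring.
by rewrite (le_trans (add_conj_le _)) // mulrC -ler_pdivlMr.
Qed.

Lemma rkhs_act_span_cts l : continuous (fun s => rkhs_act s (rkhs_span k l)).
Proof.
elim: l => [|[c x] l IH] s.
  rewrite (_ : (fun s => _) = fun=> 0); first exact: cvg_cst.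
  by apply/funext => t; apply/val_inj/funext => y /=; rewrite /kspan big_nil.
have -> : (fun t => rkhs_act t (rkhs_span k ((c, x) :: l))) =
    (fun t => c *: rkhs_act t (rkhs_vec x) + rkhs_act t (rkhs_span k l)).
  apply/funext => t; rewrite -rkhs_act_linear -rkhs_span_scale -rkhs_span_cat.
  by rewrite /comb_scale /= mulr1.
apply: cvgD; last exact: IH.
by apply: cvgZl_tmp; apply: rkhs_act_vec_cts.
Qed.

Lemma rkhs_act_cts F : continuous (fun s => rkhs_act s F).
Proof.
move=> s; apply/cvgrPdist_le => _ /complex_gt0_real [e e0 ->].
have e3 : 0 < e / 3 by rewrite divr_gt0.
have [l Fl] := rkhs_span_dense F e3.
have e3' : 0 < (e / 3)%:C%C by rewrite ltcR.
have := @rkhs_act_span_cts l s => /cvgrPdist_le /(_ _ e3').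
apply: filterS => t H; set S := rkhs_span k l in Fl H.
have D u : `|rkhs_act u F - rkhs_act u S| <= (e / 3)%:C%C.
  by rewrite -scaleN1r addrC -rkhs_act_linear norm_rkhs_act scaleN1r addrC.
have -> : rkhs_act s F - rkhs_act t F = (rkhs_act s F - rkhs_act s S) +
    (rkhs_act s S - rkhs_act t S) - (rkhs_act t F - rkhs_act t S).
  by rewrite addrA subrK opprB addrA subrK.
have -> : e = e / 3 + e / 3 + e / 3 by field.
rewrite !rmorphD; apply: le_trans (ler_normB _ _) _; apply: lerD; last exact: D.
by apply: le_trans (ler_normD _ _) _; apply: lerD; [exact: D | exact: H].
Qed.

Lemma rkhs_act_rep : cts_unitary_rep rkhs_act.
Proof.
split; [exact: rkhs_act_linear | exact: inner_rkhs_act | exact: rkhs_act1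
  | exact: rkhs_actM | exact: rkhs_act_cts].
Qed.

End KernelRep.

(** * Schur products and powers of coefficient functions *)

Lemma big_all0 (V : nmodType) (I : Type) (r : seq I) (F : I -> V) :
  all (fun i => F i == 0) r -> \sum_(i <- r) F i = 0.
Proof.
by elim: r => [|i r IH] /=; rewrite ?big_nil // big_cons => /andP[/eqP -> /IH ->]; rewrite addr0.
Qed.

Section Schur.
Variables (R : realType) (X : Type) (k : pdKernel R X) (V : hilbertType R).
Local Notation C := R[i].

(** Gram-Schmidt on the vectors a x: projecting all of them off the unit vector
    e splits <a x, a y> into t x (t y)^* + <a' x, a' y>.  The first part keeps
    the kernel positive, and one more of the vectors a' vanishes.  The list l2
    collects the entries whose vector is already 0. *)
Lemma schur_pos (a : X -> V) (l : seq (C * X)) :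
  0 <= \sum_(p <- l) \sum_(q <- l) p.1 * q.1^* * (inner (a p.2) (a q.2) * k p.2 q.2).
Proof.
suff main l1 : forall l2 (b : X -> V), all (fun p : C * X => b p.2 == 0) l2 ->
    0 <= \sum_(p <- catrev l1 l2) \sum_(q <- catrev l1 l2)
      p.1 * q.1^* * (inner (b p.2) (b q.2) * k p.2 q.2).
  by have := main (rev l) [::] a isT; rewrite -/(rev (rev l)) revK.
elim: l1 => [|p l1 IH] l2 b b0 /=.
  rewrite big_all0 //; apply: sub_all b0 => p /eqP p0; apply/eqP.
  by rewrite big1 // => q _; rewrite p0 inner0l mul0r mulr0.
have [p0|pn0] := eqVneq (b p.2) 0; first by apply: IH; rewrite /= p0 eqxx.
have [e e1 pe] : exists2 e : V, inner e e = 1 & inner (b p.2) e *: e = b p.2.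
  have bn0 : `|b p.2| != 0 by rewrite normr_eq0.
  have nr : (`|b p.2|^-1)^* = `|b p.2|^-1 :> C by apply/CrealP; rewrite rpredV normr_real.
  exists (`|b p.2|^-1 *: b p.2); rewrite ?innerZl innerZr nr inner_norm ?scalerA; first by field.
  by rewrite (_ : _ * _ = 1) ?scale1r //; field.
pose t x := inner (b x) e; pose b' x := b x - t x *: e.
have E x y : inner (b x) (b y) = t x * (t y)^* + inner (b' x) (b' y).
  rewrite /b' !innerBl !innerBr !innerZl !innerZr e1 -/(t x).
  by rewrite [inner e (b y)]inner_conj -/(t y); ring.
under eq_bigr do under eq_bigr do rewrite E mulrDl mulrDr.
under eq_bigr do rewrite big_split.
rewrite big_split /= addr_ge0 //.
  have := kernel_pos k [seq (q.1 * t q.2, q.2) | q <- catrev l1 (p :: l2)].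
  rewrite big_map; congr (0 <= _); apply: eq_bigr => q _; rewrite big_map.
  by apply: eq_bigr => r _ /=; rewrite rmorphM /=; ring.
apply: IH => /=; apply/andP; split.
  by rewrite /b' /t pe subrr.
by apply: sub_all b0 => q /eqP q0; rewrite /b' /t q0 inner0l scale0r subrr.
Qed.

Lemma schur_conj (a : X -> V) x y :
  inner (a y) (a x) * k y x = (inner (a x) (a y) * k x y)^*.
Proof. by rewrite rmorphM /= -inner_conj -kernel_conj. Qed.

Definition schur_kernel (a : X -> V) : pdKernel R X :=
  PDKernel (schur_conj a) (schur_pos a).

End Schur.

Section PowerKernel.
Variables (R : realType).
Local Notation C := R[i].

Lemma const_conj (X : Type) (x y : X) : 1 = 1^* :> C.
Proof. by rewrite rmorph1. Qed.

Lemma const_pos (X : Type) (l : seq (C * X)) :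
  0 <= \sum_(p <- l) \sum_(q <- l) p.1 * q.1^* * 1.
Proof.
have -> : \sum_(p <- l) \sum_(q <- l) p.1 * q.1^* * 1 = `|\sum_(p <- l) p.1| ^+ 2.
  rewrite normCK rmorph_sum mulr_suml; apply: eq_bigr => p _.
  by rewrite mulr_sumr; apply: eq_bigr => q _; rewrite mulr1.
by rewrite exprn_ge0.
Qed.

Definition const_kernel (X : Type) : pdKernel R X :=
  PDKernel (@const_conj X) (@const_pos X).

Variable V : hilbertType R.

Definition inner_power_kernel n : pdKernel R V :=
  iter n (fun k => schur_kernel k (@id V)) (const_kernel V).

Lemma inner_power_kernelE n x y : inner_power_kernel n x y = inner x y ^+ n.
Proof. by elim: n => [|n IH] //=; rewrite exprS IH. Qed.

End PowerKernel.

Section FSNorm.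
Variables (R : realType) (G : lcGroupType).
Local Notation C := R[i].

Lemma fs_norm_le (V : hilbertType R) (pi : G -> V -> V) xi eta (r : R) :
  cts_unitary_rep pi -> r%:C%C = `|xi| * `|eta| -> fs_norm (coef pi xi eta) <= r.
Proof.
move=> hpi hr; apply: ge_inf; last by exists V, pi, xi, eta.
by exists 0 => b [W [s [x [y [_ _ E]]]]]; rewrite -ler0c E mulr_ge0.
Qed.

Lemma fs_norm_ge0 (u : G -> C) : fourier_stieltjes u -> 0 <= fs_norm u.
Proof.
move=> [V [pi [xi [eta [hpi ->]]]]]; apply: lb_le_inf.
  exists (complex.Re (`|xi| * `|eta|)), V, pi, xi, eta; split => //.
  by rewrite RRe_real // ger0_real // mulr_ge0.
by move=> b [W [s [x [y [_ _ E]]]]]; rewrite -ler0c E mulr_ge0.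
Qed.

Lemma unitary_norm (V : hilbertType R) (pi : G -> V -> V) s x :
  cts_unitary_rep pi -> `|pi s x| = `|x|.
Proof.
move=> [_ iso _ _ _]; apply/eqP; rewrite -(@eqrXn2 _ 2) //.
by rewrite -!inner_norm iso.
Qed.

Lemma norm_coef_le (V : hilbertType R) (pi : G -> V -> V) xi eta s :
  cts_unitary_rep pi -> `|coef pi xi eta s| <= `|xi| * `|eta|.
Proof.
by move=> hpi; rewrite (le_trans (inner_cauchy_schwarz _ _)) // unitary_norm.
Qed.

(** The n-th power is a coefficient function of the kernel <x | y>^n on V, that
    is, of the n-th tensor power of pi at the tensor powers of xi and eta. *)
Lemma fs_norm_coef_expn (V : hilbertType R) (pi : G -> V -> V) xi eta (r : R) n :
  cts_unitary_rep pi -> r%:C%C = `|xi| * `|eta| ->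
  fs_norm (fun s => coef pi xi eta s ^+ n) <= r ^+ n.
Proof.
move=> hpi hr; have [lin iso p1 pM cts] := hpi.
pose k := inner_power_kernel V n.
have k1 x : pi 1%g x = x by rewrite p1.
have kM s t x : pi (s * t)%g x = pi s (pi t x) by rewrite pM.
have kinv s x y : k (pi s x) (pi s y) = k x y by rewrite !inner_power_kernelE iso.
have kc x y : continuous (fun s => k (pi s x) y : C^o).
  rewrite (_ : (fun s => _) = fun s => inner (pi s x) y ^+ n); last first.
    by apply/funext => s; rewrite inner_power_kernelE.
  elim: n {k kinv} => [|n IH] s; first exact: cvg_cst.
  rewrite (_ : (fun s => _) = fun s => inner (pi s x) y * inner (pi s x) y ^+ n); last first.
    by apply/funext => t; rewrite exprS.
  by apply: cvgM; [apply: cvg_innerl; apply: cts | exact: IH].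
have -> : (fun s => coef pi xi eta s ^+ n) =
    coef (rkhs_act kinv) (rkhs_vec k xi) (rkhs_vec k eta).
  apply/funext => s; rewrite /coef rkhs_act_vec // inner_rkhs_vec.
  by rewrite inner_power_kernelE.
apply: fs_norm_le; first exact: rkhs_act_rep.
apply/eqP; rewrite -(@eqrXn2 _ 2) ?mulr_ge0 // ?ler0c; last first.
  by rewrite exprn_ge0 // -ler0c hr mulr_ge0.
rewrite exprMn -!inner_norm !inner_rkhs_vec !inner_power_kernelE !inner_norm.
by rewrite rmorphXn /= hr !exprMn -!exprM muln2 -addnn !exprD.
Qed.

End FSNorm.

(** * The spectrum consists of nonzero contractions *)

Lemma expn_bound (R : realType) (a b M : R) : 0 <= a -> 0 <= b ->
  (forall n, a ^+ n.+1 <= M * b ^+ n.+1) -> a <= b.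
Proof.
move=> a0 b0 H; rewrite leNgt; apply/negP => ba.
have ap : 0 < a by apply: le_lt_trans ba.
have : (fun n => M * (b / a) ^+ n) n @[n --> \oo] --> M * 0.
  by apply: cvgMl_tmp; apply: cvg_expr; rewrite ger0_norm ?divr_ge0 // ltr_pdivrMr // mul1r.
rewrite mulr0 => /cvgrPdist_lt /(_ _ ltr01) /= [N _ /(_ N.+1)] /(_ (leqnSn _)) /=.
rewrite sub0r normrN => /(le_lt_trans (ler_norm _)).
rewrite expr_div_n mulrA ltr_pdivrMr ?exprn_gt0 // mul1r => /(le_lt_trans (H N)).
by rewrite ltxx.
Qed.

Section Spectrum.
Variables (R : realType) (G : lcGroupType) (V : hilbertType R) (pi : G -> V -> V).
Hypothesis pi_rep : cts_unitary_rep pi.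
Local Notation C := R[i].
Local Notation A := (coef_space pi).
Hypothesis A_alg : closed_unital_invariant_subalgebra A.
Implicit Types (T S : V -> V).

(** The bounded operators form a von Neumann algebra that contains pi (G). *)
Lemma vn_rep_bounded T : vn_rep pi T -> bounded_op T.
Proof.
apply; split; first split => //.
  by apply/seteqP; split => [T' []|T' T'b] //; split => // X [_ ->].
move=> _ [s _ <-]; have [lin _ _ _ _] := pi_rep; split; first exact: lin.
move=> x; apply/cvgrPdist_le => e e0.
have := @cvg_id _ (nbhs x) => /cvgrPdist_le /(_ _ e0); apply: filterS => y.
have -> : pi s x - pi s y = pi s (x - y).
  by have := lin s (-1) y x; rewrite !scaleN1r ![- _ + _]addrC.
by rewrite unitary_norm.
Qed.

Lemma spectrum_linear T : spectrum pi T -> linear T.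
Proof. by case=> /vn_rep_bounded []. Qed.

Lemma coef0 : coef pi 0 0 = (fun=> 0).
Proof. by apply/funext => s; rewrite /coef inner0r. Qed.

Lemma coef_in xi eta : A (coef pi xi eta).
Proof.
have fs : fourier_stieltjes (coef pi xi eta) by exists V, pi, xi, eta.
split => // e e0; exists (coef pi xi eta).
  exists 1%N, (fun=> 1), (fun=> xi), (fun=> eta).
  by apply/funext => s; rewrite big_ord1 mul1r.
rewrite (_ : _ \- _ = coef pi 0 0); last first.
  by rewrite coef0; apply/funext => s; exact: subrr.
by apply: le_lt_trans e0; apply: fs_norm_le; rewrite // normr0 mul0r.
Qed.

Lemma coef_span_in v : coef_span pi v -> A v /\
  forall f T, represents pi T f -> (forall x, T x = 0) -> f v = 0.
Proof.
move=> [n [c [xi [eta ->]]]]; elim: n c xi eta => [|n IH] c xi eta.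
  rewrite (_ : (fun s => _) = coef pi 0 0); last first.
    by rewrite coef0; apply/funext => s; rewrite big_ord0.
  split; first exact: coef_in.
  by move=> f T [_ ->] _; rewrite inner0r.
rewrite (_ : (fun s => _) = fun s => c ord0 * coef pi (xi ord0) (eta ord0) s +
    \sum_i c (lift ord0 i) * coef pi (xi (lift ord0 i)) (eta (lift ord0 i)) s); last first.
  by apply/funext => s; rewrite big_ord_recl.
have [IHA IHf] := IH (c \o lift ord0) (xi \o lift ord0) (eta \o lift ord0).
split; first by apply: (subalg_linear A_alg) => //; exact: coef_in.
move=> f T fT T0; have [[lin _] fc] := fT.
rewrite lin //; last exact: coef_in.
by rewrite fc T0 inner0l mulr0 add0r; apply: IHf fT T0.
Qed.

(** A character that vanishes on the coefficient functions of pi vanishes on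
    their closed span. *)
Lemma spectrum_neq0 T : spectrum pi T -> exists x, T x != 0.
Proof.
move=> [_ [f [fT _ [u Au fu]]]]; apply: contrapT => T0.
have {}T0 x : T x = 0 by apply: contrapT => /eqP Tx; apply: T0; exists x.
have [[lin [M HM]] _] := fT.
have [a a0 fa] : exists2 a : R, 0 < a & `|f u| = a%:C%C.
  by apply: complex_gt0_real; rewrite normr_gt0.
have M1 : 0 < `|M| + 1 by rewrite ltr_wpDl.
have e0 : 0 < a / (`|M| + 1) by rewrite divr_gt0.
have [v sv nv] := Au.2 _ e0; have [Av fv] := coef_span_in sv.
have E : u \- v = (fun s => -1 * v s + u s) by apply/funext => s; rewrite mulN1r addrC.
have Auv : A (u \- v) by rewrite E; apply: subalg_linear.
have := HM _ Auv; rewrite {1}E lin // (fv _ _ fT T0) mulr0 add0r fa lecR => aM.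
have : `|M| * fs_norm (u \- v) < a.
  apply: le_lt_trans (_ : `|M| * (a / (`|M| + 1)) < _); first by rewrite ler_wpM2l // ltW.
  by rewrite mulrA ltr_pdivrMr // mulrC ltr_pM2l // ltrDl.
rewrite ltNge => /negP; apply; apply: le_trans aM _.
by apply: ler_wpM2r; [apply: fs_norm_ge0; exact: subalg_sub Auv | exact: ler_norm].
Qed.

Lemma pairing_coef T xi eta : spectrum pi T ->
  pairing pi T (coef pi xi eta) = inner (T xi) eta.
Proof.
move=> [_ [f [fT _ _]]]; rewrite /pairing.
by case: (xgetP (fun=> 0) [set f | represents pi T f]) => [g _ [_ ->] //|/(_ f)].
Qed.

(** The spectral radius argument for characters: |f u|^n = |f (u^n)| is at most
    M (|xi| |eta|)^n for all n. *)
Lemma spectrum_coef_le T xi eta : spectrum pi T ->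
  `|inner (T xi) eta| <= `|xi| * `|eta| :> C.
Proof.
move=> [_ [f [[[lin [M HM]] fc] fM _]]]; rewrite -fc; set u := coef pi xi eta.
have Au n : A (fun s => u s ^+ n.+1) /\ f (fun s => u s ^+ n.+1) = f u ^+ n.+1.
  elim: n => [|n [IHA IHf]]; first by split; [exact: coef_in | ].
  rewrite (_ : (fun s => _) = fun s => u s * u s ^+ n.+1); last first.
    by apply/funext => s; rewrite exprS.
  rewrite exprS fM ?IHf //; last exact: coef_in.
  by split => //; apply: (subalg_mul A_alg) => //; exact: coef_in.
pose r := complex.Re (`|xi| * `|eta|).
have rE : r%:C%C = `|xi| * `|eta| by rewrite RRe_real // ger0_real // mulr_ge0.
have M0 n : complex.Re `|f u| ^+ n.+1 <= `|M| * r ^+ n.+1.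
  rewrite -lecR rmorphXn /= Re_norm -normrX -(Au n).2.
  apply: le_trans (HM _ (Au n).1) _; rewrite lecR.
  apply: le_trans (_ : `|M| * fs_norm (fun s => u s ^+ n.+1) <= _).
    by apply: ler_wpM2r; [apply: fs_norm_ge0; exact: subalg_sub (Au n).1 | exact: ler_norm].
  by rewrite ler_wpM2l //; apply: fs_norm_coef_expn.
rewrite -rE -Re_norm lecR; apply: expn_bound M0; rewrite -ler0c ?Re_norm ?rE //.
Qed.

Lemma spectrum_contraction T x : spectrum pi T -> `|T x| <= `|x|.
Proof.
move=> sT; have [->|Tx] := eqVneq (T x) 0; first by rewrite normr0.
rewrite -(@ler_pM2r _ `|T x|) ?normr_gt0 // -expr2 -inner_norm.
by rewrite -[leLHS]ger0_norm ?inner_ge0 // spectrum_coef_le.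
Qed.

End Spectrum.

(** * Positive families of operators on a group *)

Section EvaluationPositivity.
Variables (R : realType) (G H : lcGroupType) (V : hilbertType R) (pi : G -> V -> V).
Local Notation C := R[i].

Lemma norm_eval_le (u : H -> C) h : fourier_stieltjes u -> `|u h| <= (fs_norm u)%:C%C.
Proof.
move=> [W [sigma [xi [eta [hs uE]]]]].
rewrite -Re_norm lecR; apply: lb_le_inf.
  exists (complex.Re (`|xi| * `|eta|)), W, sigma, xi, eta; split => //.
  by rewrite RRe_real // ger0_real // mulr_ge0.
move=> r [W' [s' [x [y [hs' -> rE]]]]].
by rewrite -lecR Re_norm rE; apply: norm_coef_le.
Qed.

(** On a representation sigma this matrix is the Gram matrix of the vectors
    sigma (g_j) xi_j. *)
Lemma eval_mx_positive n (g : 'I_n -> H) :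
  @wstar_mx_positive R H n (fun i j u => u ((g i)^-1 * g j)%g).
Proof.
split=> [i j|W sigma hs xi].
  by split => //; exists 1 => u fu; rewrite mul1r; exact: norm_eval_le.
have [lin iso s1 sM _] := hs.
rewrite (_ : \sum_i _ = inner (\sum_j sigma (g j) (xi j)) (\sum_i sigma (g i) (xi i))).
  exact: inner_ge0.
rewrite inner_sumr; apply: eq_bigr => i _; rewrite inner_suml; apply: eq_bigr => j _.
rewrite /coef -(iso (g i)) -[sigma _ (sigma _ _)]/((sigma _ \o sigma _) _) -sM.
by rewrite mulgA mulgV mul1g.
Qed.

Lemma n_positive_kernel n (phi : (G -> C) -> H -> C) (g : 'I_n -> H) (xi : 'I_n -> V) :
  n_positive pi n phi ->
  0 <= \sum_i \sum_j phi (coef pi (xi j) (xi i)) ((g i)^-1 * g j)%g.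
Proof. by move=> /(_ _ (eval_mx_positive g)) /(_ xi). Qed.

End EvaluationPositivity.

Section PositiveFamily.
Variables (R : realType) (H : lcGroupType) (V : hilbertType R) (b : H -> V -> V).
Local Notation C := R[i].
Hypothesis b_lin : forall h, linear (b h).

Let P g h x y : C := inner (b (g^-1 * h)%g y) x.

(* Positivity of the matrices [b (g_i^-1 g_j)] of size 3. *)
Hypothesis b_pos : forall g1 g2 g3 x1 x2 x3,
  0 <= (P g1 g1 x1 x1 + P g1 g2 x1 x2 + P g1 g3 x1 x3)
     + (P g2 g1 x2 x1 + P g2 g2 x2 x2 + P g2 g3 x2 x3)
     + (P g3 g1 x3 x1 + P g3 g2 x3 x2 + P g3 g3 x3 x3).

Lemma pos_family0 h : b h 0 = 0.
Proof. by have := b_lin h (-1) 0 0; rewrite scaler0 addr0 scaleN1r addNr. Qed.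

Lemma pos_familyZ h (c : C) x : b h (c *: x) = c *: b h x.
Proof. by have := b_lin h c x 0; rewrite !addr0 pos_family0 addr0. Qed.

Lemma pos_familyN h x : b h (- x) = - b h x.
Proof. by rewrite -scaleN1r pos_familyZ scaleN1r. Qed.

Lemma pos_family_pair h x y :
  0 <= inner (b 1%g x) x + (inner (b h y) x + inner (b h^-1%g x) y) + inner (b 1%g y) y.
Proof.
have := b_pos 1%g h 1%g x y 0; rewrite /P invg1 !mul1g mulg1 mulVg.
by rewrite !pos_family0 !inner0l !inner0r !addr0 !addrA.
Qed.

Lemma pos_family1_ge0 x : 0 <= inner (b 1%g x) x.
Proof. by have := pos_family_pair 1%g x 0; rewrite pos_family0 !inner0l !inner0r !addr0. Qed.

(** The cross terms of the positive form at (x, t y) are real for every t. *)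
Lemma pos_family_adj h x y : inner (b h^-1%g x) y = inner x (b h y).
Proof.
rewrite [RHS]inner_conj.
apply: (@semilinear_coef_eq C _ (inner (b h y) x) _ (inner (b h^-1%g x) y)^*) => t.
have := pos_family_pair h x (t *: y); rewrite !pos_familyZ !innerZl !innerZr.
set s := (X in _ <= _ + X + _); move=> /ger0_real sr.
have {}sr : s \is Num.real.
  have -> : s = (inner (b 1%g x) x + s + t * (t^* * inner (b 1%g y) y))
     - inner (b 1%g x) x - t * t^* * inner (b 1%g y) y by ring.
  rewrite rpredB // ?rpredB // ?ger0_real ?pos_family1_ge0 //.
  by rewrite mulr_ge0 ?pos_family1_ge0 // -normCK exprn_ge0.
rewrite addrC -/s -(CrealP sr) /s rmorphD !rmorphM /= conjCK; ring.
Qed.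

Lemma pos_family_cauchy_schwarz h x y :
  `|inner (b h y) x| ^+ 2 <= inner (b 1%g x) x * inner (b 1%g y) y.
Proof.
apply: quadratic_ge0; rewrite ?pos_family1_ge0 // => t.
have := pos_family_pair h x (t *: y); rewrite pos_family_adj !pos_familyZ !innerZl !innerZr.
by rewrite rmorphM /= [inner x (b h y)]inner_conj mulrA.
Qed.

(** Think of b (g^-1 h) as V_g^* V_h.  Then |V_k x - V_1 (b k x)|^2 =
    <b 1 x | x> - |b k x|^2 = 0, so V_k x = V_1 (b k x), and applying V_{h^-1}^*
    gives the claim.  Without the operators V the same is read off from the
    positivity of the form at the vectors t^* y, - b k x, x. *)
Lemma pos_family_mul h k : b 1%g \o b k = b k ->
  (forall x, inner (b 1%g x) x = `|b k x| ^+ 2) ->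
  b (h * k)%g = b h \o b k.
Proof.
move=> ek nk; apply/funext => x; apply: inner_inj => y /=; apply/eqP.
rewrite -subr_eq0 -normr_eq0; set z := inner _ y - inner _ y.
suff : `|z| ^+ 2 <= 0 * inner (b 1%g y) y.
  rewrite mul0r => z0; have : `|z| ^+ 2 == 0 by rewrite eq_le z0 exprn_ge0.
  by rewrite expf_eq0.
apply: quadratic_ge0; rewrite ?pos_family1_ge0 // => t.
have ekx : b 1%g (b k x) = b k x by rewrite -[LHS]/((b 1%g \o b k) x) ek.
have := b_pos h^-1%g 1%g k (t^* *: y) (- b k x) x.
rewrite /P !invgK !mulgV !mulVg invg1 !mul1g mulg1 -invgM mulg1.
rewrite !pos_family_adj !pos_familyN !pos_familyZ !innerZl !innerZr !innerNl !innerNr !ekx.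
rewrite conjCK !nk -!inner_norm.
rewrite rmorphM rmorphB /= -!inner_conj; congr (0 <= _); rewrite /z; ring.
Qed.

End PositiveFamily.

(** * Positive maps come from homomorphisms *)

Section PositiveToHomomorphism.
Variables (R : realType) (G H : lcGroupType) (V : hilbertType R) (pi : G -> V -> V).
Local Notation C := R[i].
Hypothesis pi_rep : cts_unitary_rep pi.
Hypothesis A_alg : closed_unital_invariant_subalgebra (coef_space pi).
Implicit Types S : set (V -> V).

(** x and its inverse are both contractions. *)
Lemma spectrum_group_norm S e x : S `<=` spectrum pi -> S e -> S x ->
  x \o e = x -> (exists2 y, S y & y \o x = e) -> forall v, `|x v| = `|e v|.
Proof.
move=> sS Se Sx xe [y Sy yx] v; apply/eqP; rewrite eq_le.
have con T w : S T -> `|T w| <= `|w| by move=> /sS; exact: spectrum_contraction.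
by apply/andP; split; [rewrite -{1}xe | rewrite -yx] => /=; apply: con.
Qed.

(** The identity e is a self-adjoint projection, because x = x^* absorbs e on
    both sides and is invertible relative to e.  As x is isometric on the range
    of e, x^2 = x^* x = e, and z = (e - x) v satisfies x z = - z; positivity of
    x forces z = 0. *)
Lemma positive_group_element S e x : S `<=` spectrum pi -> S e -> S x ->
  e \o x = x -> x \o e = x ->
  (exists2 y, S y & y \o x = e /\ x \o y = e) ->
  (forall v w, inner (x v) w = inner v (x w)) ->
  (forall v, 0 <= inner (x v) v) -> x = e.
Proof.
move=> sS Se Sx ex xe [y Sy [yx xy]] adj pos.
have lin T : S T -> linear T by move=> /sS; exact: spectrum_linear.
have xnorm v : `|x v| = `|e v| by apply: (spectrum_group_norm sS Se Sx xe); exists y.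
have e_proj v w : inner (e v) (e w) = inner v (e w).
  by rewrite -xy /= -!adj -[x (x (y v))]/(x ((x \o y) v)) xy -[x (e v)]/((x \o e) v) xe.
have e_adj v w : inner (e v) w = inner v (e w).
  by rewrite -e_proj [RHS]inner_conj e_proj -inner_conj.
have xx : x \o x = e.
  have lxx : linear (x \o x) by move=> c v w; rewrite /= !(lin _ Sx).
  apply: linear_polarization lxx (lin _ Se) _ => v.
  by rewrite /= adj inner_norm xnorm -inner_norm e_proj e_adj.
apply/funext => v; apply/eqP; rewrite eq_sym -subr_eq0; set z := e v - x v.
have xz : x z = - z.
  have -> : z = -1 *: x v + e v by rewrite scaleN1r addrC.
  rewrite (lin _ Sx) -[x (x v)]/((x \o x) v) xx -[x (e v)]/((x \o e) v) xe.
  by rewrite !scaleN1r opprD opprK addrC.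
have := pos z; rewrite xz innerNl oppr_ge0 inner_norm => z0.
have : `|z| ^+ 2 == 0 by rewrite eq_le z0 exprn_ge0.
by rewrite expf_eq0 normr_eq0.
Qed.

Variables (Y : set H) (alpha : H -> V -> V).
Hypothesis alpha_spec : alpha @` Y `<=` spectrum pi.

Lemma alpha_in h : Y h -> spectrum pi (alpha h).
Proof. by move=> Yh; apply: alpha_spec; exists h. Qed.

Definition extend0 h : V -> V := fun x => if h \in Y then alpha h x else 0.

Lemma extend0_in h : Y h -> extend0 h = alpha h.
Proof. by move=> Yh; apply/funext => x; rewrite /extend0 mem_set. Qed.

Lemma extend0_linear h : linear (extend0 h).
Proof.
move=> c x y; rewrite /extend0; case: ifPn => [/set_mem Yh|_]; last by rewrite scaler0 addr0.
exact: (spectrum_linear pi_rep (alpha_in Yh)).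
Qed.

Lemma extend0_neq0 h : (exists x, extend0 h x != 0) <-> Y h.
Proof.
split => [[x]|Yh]; last first.
  by rewrite extend0_in //; apply: (spectrum_neq0 pi_rep A_alg); apply: alpha_in.
by rewrite /extend0; case: ifPn => [/set_mem //|_]; rewrite eqxx.
Qed.

Lemma jmap_coef xi eta h : jmap pi Y alpha (coef pi xi eta) h = inner (extend0 h xi) eta.
Proof.
rewrite /jmap /extend0; case: ifPn => [/set_mem Yh|_]; last by rewrite inner0l.
by rewrite pairing_coef //; apply: alpha_in.
Qed.

Variable phi : (G -> C) -> H -> C.
Hypothesis phi_nz : exists2 u, coef_space pi u & phi u <> (fun=> 0).
Hypothesis phi_j : forall u, coef_space pi u -> phi u = jmap pi Y alpha u.

Lemma phi_coef xi eta h : phi (coef pi xi eta) h = inner (extend0 h xi) eta.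
Proof. by rewrite phi_j ?jmap_coef //; apply: coef_in. Qed.

(** A matrix of size 3 is a matrix of size 4 whose last vector is 0. *)
Lemma extend0_pos : n_positive pi 4 phi -> forall g1 g2 g3 x1 x2 x3,
  let P g h x y := inner (extend0 (g^-1 * h)%g y) x : C in
  0 <= (P g1 g1 x1 x1 + P g1 g2 x1 x2 + P g1 g3 x1 x3)
     + (P g2 g1 x2 x1 + P g2 g2 x2 x2 + P g2 g3 x2 x3)
     + (P g3 g1 x3 x1 + P g3 g2 x3 x2 + P g3 g3 x3 x3).
Proof.
move=> pos4 g1 g2 g3 x1 x2 x3 /=.
have := n_positive_kernel (fun i : 'I_4 => nth 1%g [:: g1; g2; g3] i)
  (fun i : 'I_4 => nth 0 [:: x1; x2; x3] i) pos4.
rewrite !big_ord_recl !big_ord0 /= !phi_coef !inner0r.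
rewrite !(pos_family0 extend0_linear) !inner0l !addr0; congr (0 <= _); ring.
Qed.

Lemma Y_neq0 : exists h, Y h.
Proof.
have [u Au pu] := phi_nz; apply: contrapT => Y0; apply: pu.
rewrite phi_j //; apply/funext => h; rewrite /jmap ifF //.
by apply/negP => /set_mem Yh; apply: Y0; exists h.
Qed.

Theorem positive_homomorphism S : open Y -> n_positive pi 4 phi ->
  subgroup_of_spectrum pi S -> alpha @` Y `<=` S ->
  [/\ open_subgroup Y,
      forall h k, Y h -> Y k -> alpha (h * k)%g = alpha h \o alpha k &
      exists p, [/\ spectrum pi p, is_projection p &
        alpha @` Y `<=` spectrum_block pi p]].
Proof.
move=> Yo pos4 [sS SM [e Se eS]] aS.
have bl := extend0_linear; have bp := extend0_pos pos4.
have adj h x y := pos_family_adj bl bp h x y.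
have cs h x y := pos_family_cauchy_schwarz bl bp h x y.
(* If b 1 were 0, the Cauchy-Schwarz inequality would make b vanish. *)
have Y1 : Y 1%g.
  have [h Yh] := Y_neq0; apply/extend0_neq0; apply: contrapT => N.
  have {}N x : extend0 1%g x = 0 by apply: contrapT => /eqP Nx; apply: N; exists x.
  have /extend0_neq0 [x] := Yh; rewrite -normr_eq0.
  have := cs h (extend0 h x) x; rewrite !N !inner0l mul0r inner_norm => n0.
  have : `| `|extend0 h x| ^+ 2| ^+ 2 == 0 :> C by rewrite eq_le n0 exprn_ge0.
  by rewrite !(expf_eq0, normr_eq0) /= => ->.
(* Otherwise b h = (b h^-1)^* would be 0. *)
have YV h : Y h -> Y h^-1%g.
  move=> Yh; apply/extend0_neq0; apply: contrapT => N.
  have {}N x : extend0 h^-1%g x = 0 by apply: contrapT => /eqP Nx; apply: N; exists x.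
  have /extend0_neq0 [x] := Yh; rewrite -normr_eq0.
  have : `|extend0 h x| ^+ 2 == 0 :> C by rewrite -inner_norm -adj N inner0l.
  by rewrite expf_eq0 /= => ->.
have Sa h : Y h -> S (alpha h) by move=> Yh; apply: aS; exists h.
have a1 : alpha 1%g = e.
  have [ex xe inv] := eS _ (Sa _ Y1); rewrite -(extend0_in Y1) in ex xe inv *.
  apply: (positive_group_element sS Se _ ex xe inv).
  - by rewrite extend0_in //; exact: Sa.
  - by move=> v w; rewrite -{1}[1%g]invg1 adj.
  - exact: pos_family1_ge0 bl bp.
have nrm k v : Y k -> inner (extend0 1%g v) v = `|extend0 k v| ^+ 2.
  move=> Yk; have [_ xe [y Sy [yx _]]] := eS _ (Sa _ Yk).
  have -> : `|extend0 k v| = `|extend0 1%g v|.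
    rewrite (extend0_in Yk) (extend0_in Y1) a1.
    by apply: (spectrum_group_norm sS Se (Sa _ Yk) xe); exists y.
  rewrite -inner_norm -adj invg1 (extend0_in Y1) a1 -[e (e v)]/((e \o e) v).
  by have [-> _ _] := eS _ Se.
have mul h k : Y k -> extend0 (h * k)%g = extend0 h \o extend0 k.
  move=> Yk; apply: (pos_family_mul bl bp); last by move=> v; exact: nrm.
  by rewrite (extend0_in Yk) (extend0_in Y1) a1; have [-> _ _] := eS _ (Sa _ Yk).
have YM h k : Y h -> Y k -> Y (h * k)%g.
  move=> Yh Yk; apply/extend0_neq0; rewrite mul // (extend0_in Yh) (extend0_in Yk).
  by apply: (spectrum_neq0 pi_rep A_alg); apply: sS; apply: SM; apply: Sa.
have aM h k : Y h -> Y k -> alpha (h * k)%g = alpha h \o alpha k.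
  by move=> Yh Yk; rewrite -!extend0_in ?mul //; exact: YM.
split => //; exists e; split; first exact: sS.
  split; first by have [-> _ _] := eS _ Se.
  by move=> v w; rewrite -a1 -(extend0_in Y1) -{1}[1%g]invg1 adj.
move=> _ [h Yh <-]; split; first exact: alpha_in.
exists (alpha h^-1%g); split.
- by apply: (vn_rep_bounded pi_rep); have [] := sS _ (Sa _ (YV _ Yh)).
- by move=> v w; rewrite -!extend0_in ?adj //; exact: YV.
- by rewrite -aM ?mulVg //; exact: YV.
- by rewrite -aM ?mulgV //; exact: YV.
Qed.

End PositiveToHomomorphism.

(** * Homomorphisms induce completely positive maps *)

Section DeltaKernel.
Variables (R : realType) (X E : eqType) (r : X -> E).
Local Notation C := R[i].

Lemma delta_conj x y : (r y == r x)%:R = (r x == r y)%:R^* :> C.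
Proof. by rewrite rmorph_nat eq_sym. Qed.

(** Grouping the entries by the value e of r gives a sum of squares. *)
Lemma delta_pos (l : seq (C * X)) :
  0 <= \sum_(p <- l) \sum_(q <- l) p.1 * q.1^* * (r p.2 == r q.2)%:R.
Proof.
pose D := undup [seq r p.2 | p <- l].
have -> : \sum_(p <- l) \sum_(q <- l) p.1 * q.1^* * (r p.2 == r q.2)%:R =
    \sum_(e <- D) `|\sum_(p <- l) p.1 * (r p.2 == e)%:R| ^+ 2.
  under [RHS]eq_bigr do rewrite normCK rmorph_sum mulr_suml.
  rewrite [RHS]exchange_big; apply: eq_big_seq => p pl /=.
  under [RHS]eq_bigr do rewrite mulr_sumr.
  rewrite [RHS]exchange_big; apply: eq_bigr => q _ /=.
  rewrite (bigD1_seq (r p.2)) ?undup_uniq ?mem_undup ?map_f //=.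
  rewrite big1 => [|e en]; last by rewrite eq_sym (negPf en) mulr0 mul0r.
  by rewrite eqxx mulr1 addr0 rmorphM rmorph_nat mulrA eq_sym.
by apply: sumr_ge0 => e _; rewrite exprn_ge0.
Qed.

Definition delta_kernel : pdKernel R X := PDKernel delta_conj delta_pos.

End DeltaKernel.

Section HomomorphismToPositive.
Variables (R : realType) (G H : lcGroupType) (V : hilbertType R) (pi : G -> V -> V).
Local Notation C := R[i].
Hypothesis pi_rep : cts_unitary_rep pi.
Variables (Y : set H) (alpha : H -> V -> V).
Hypothesis alpha_spec : alpha @` Y `<=` spectrum pi.
Hypothesis alpha_cts : weakstar_continuous_on pi Y alpha.
Hypothesis Y_subgroup : open_subgroup Y.
Hypothesis alphaM : forall h k, Y h -> Y k -> alpha (h * k)%g = alpha h \o alpha k.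
Variable p : V -> V.
Hypothesis p_proj : is_projection p.
Hypothesis alpha_block : alpha @` Y `<=` spectrum_block pi p.

Local Notation ext := (extend0 Y alpha).

Let Yopen : open Y. Proof. by case: Y_subgroup. Qed.
Let Y1 : Y 1%g. Proof. by case: Y_subgroup. Qed.
Let YM h k : Y h -> Y k -> Y (h * k)%g. Proof. by case: Y_subgroup => _ _ + _; apply. Qed.
Let YV h : Y h -> Y h^-1%g. Proof. by case: Y_subgroup => _ _ _; apply. Qed.

Lemma image_subgroup : subgroup_of_spectrum pi (alpha @` Y).
Proof.
split => //; first by move=> _ _ [h Yh <-] [k Yk <-]; exists (h * k)%g; [exact: YM | exact: alphaM].
exists (alpha 1%g); first by exists 1%g.
move=> _ [h Yh <-]; rewrite -!alphaM // mul1g mulg1; split => //.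
exists (alpha h^-1%g); first by exists h^-1%g => //; exact: YV.
by rewrite -!alphaM ?mulgV ?mulVg //; exact: YV.
Qed.

(** The idempotent q = alpha 1 satisfies q^* q = q q^* = p, so q and q^* have the
    same kernel.  As q kills v - q v, so does q^*; hence q^* = q^* q = p. *)
Lemma alpha_unit : alpha 1%g = p.
Proof.
have [_ [y [[ly _] adj yq qy]]] : spectrum_block pi p (alpha 1%g) by apply: alpha_block; exists 1%g.
have qq : alpha 1%g \o alpha 1%g = alpha 1%g by rewrite -alphaM ?mulg1.
have lq : linear (alpha 1%g) by apply: (spectrum_linear pi_rep); apply: alpha_spec; exists 1%g.
have yp : y = p.
  apply/funext => v; pose w := v - alpha 1%g v.
  have qw : alpha 1%g w = 0.
    rewrite /w -[v - _](addrC (- _)) -scaleN1r lq.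
    rewrite -[alpha _ (alpha _ v)]/((alpha 1%g \o alpha 1%g) v) qq.
    by rewrite scaleN1r addNr.
  have yw : y w = 0.
    apply/eqP; have : `|y w| ^+ 2 == 0 :> C.
      rewrite -inner_norm adj -[alpha _ (y w)]/((alpha 1%g \o y) w) qy -yq /= qw.
      by have := ly (-1) 0 0; rewrite scaler0 addr0 scaleN1r addNr => ->; rewrite inner0r.
    by rewrite expf_eq0 normr_eq0.
  have := ly (-1) (alpha 1%g v) v; rewrite !scaleN1r [- _ + v]addrC -/w yw => /esym/eqP.
  by rewrite addrC subr_eq0 -yq => /eqP.
apply/funext => v; apply/esym; apply: inner_inj => w.
by rewrite (p_proj.2 v) [RHS]inner_conj -adj yp -inner_conj.
Qed.

(** If z is the adjoint of alpha h, then alpha h^-1 = alpha h^-1 (alpha h z) =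
    p z = z. *)
Lemma alphaV_adj h x y : Y h -> inner (alpha h^-1%g x) y = inner x (alpha h y).
Proof.
move=> Yh; have [_ [z [_ adj zh hz]]] : spectrum_block pi p (alpha h).
  by apply: alpha_block; exists h.
rewrite -adj; congr (inner _ y); move: x y.
suff -> : alpha h^-1%g = z by [].
have pz : p \o z = z.
  apply/funext => v; apply: inner_inj => w /=.
  by rewrite p_proj.2 !adj -[alpha h (p w)]/((alpha h \o p) w) -alpha_unit -alphaM // mulg1.
rewrite -pz -alpha_unit -(mulVg h) alphaM //; last exact: YV.
by rewrite -compA hz -alpha_unit -alphaM ?mulg1 //; exact: YV.
Qed.

Lemma mulg_cvg (a c : H) : continuous (fun s : H => (a * s * c)%g).
Proof.
have M (f g : H -> H) : continuous f -> continuous g -> continuous (fun s => (f s * g s)%g).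
  move=> cf cg s.
  apply: (@cvg_comp _ _ _ (fun s => (f s, g s)) (fun x : H * H => (x.1 * x.2)%g) _
    (nbhs (f s, g s))).
    by apply: cvg_pair; [exact: cf | exact: cg].
  exact: (@mulg_continuous H (f s, g s)).
by apply: (M); [apply: M => s; [exact: cvg_cst | exact: cvg_id] | move=> s; exact: cvg_cst].
Qed.

(** An open subgroup is closed, so extending by 0 keeps continuity. *)
Lemma extend0_continuous x y : continuous (fun h => inner (ext h x) y : C^o).
Proof.
move=> h; have [Yh|nYh] := pselect (Y h).
  have := alpha_cts; rewrite /weakstar_continuous_on continuous_open_subspace //.
  move=> /(_ h (mem_set Yh)) ch.
  have uA : coef pi x y \in coef_space pi by apply/mem_set; exact: coef_in.
  have := @cvg_comp _ _ _ _ _ _ _ _ ch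
    (@proj_continuous _ (fun=> C^o) (SigSub uA) (fun u => pairing pi (alpha h) (\val u))).
  rewrite /proj /= => ch'.
  have Yn : \forall k \near h, Y k by exact: open_nbhs_nbhs.
  have E k : Y k -> pairing pi (alpha k) (coef pi x y) = inner (ext k x) y.
    move=> Yk; rewrite extend0_in // pairing_coef //; apply: alpha_spec; by exists k.
  rewrite /continuous_at -E //; apply: cvg_trans ch'; apply: near_eq_cvg.
  by apply: filterS Yn => k Yk /=; rewrite E.
have E k : ~ Y k -> inner (ext k x) y = 0.
  by move=> nYk; rewrite /extend0 ifF ?inner0l //; apply/negP => /set_mem.
rewrite /continuous_at E //.
apply: cvg_near_cst.
have := @mulg_cvg h^-1%g 1%g h; move=> /(_ Y) /= Hn.
have : nbhs h (fun s => Y (h^-1 * s * 1)%g).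
  by apply: Hn; rewrite mulVg mul1g; exact: open_nbhs_nbhs.
apply: filterS => s; rewrite mulg1 => Ys; rewrite E // => /YV Y'; apply: nYh.
by have := YV (YM Ys Y'); rewrite mulgK invgK.
Qed.

Section CoefficientKernel.
Variables (n : nat) (xi : 'I_n -> V).
Local Notation X := (H * 'I_n)%type.

(* A representative of the coset h Y: the set on the right depends only on that
   coset. *)
Let rep (h : H) : H := xget 1%g [set g | Y (g^-1 * h)%g].
Let vec (x : X) : V := ext ((rep x.1)^-1 * x.1)%g (xi x.2).

Let repP h : Y ((rep h)^-1 * h)%g.
Proof. by apply: (@xgetPex _ 1%g [set g | Y (g^-1 * h)%g]); exists h; rewrite /= mulVg. Qed.

(** This kernel describes the representation induced from Y.  Its positivity is
    read off from vectors attached to coset representatives: it is the Schur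
    product of a Gram matrix with the indicator of lying in the same coset. *)
Lemma coset_kernelE (x y : X) :
  inner (ext (y.1^-1 * x.1)%g (xi x.2)) (xi y.2) =
  schur_kernel (delta_kernel R (fun z : X => rep z.1)) vec x y.
Proof.
rewrite /=; have [Yxy|nY] := pselect (Y (y.1^-1 * x.1)%g).
  have rE : rep x.1 = rep y.1.
    congr (xget _ _); apply/seteqP; split => g /= Yg.
      by have := YM Yg (YV Yxy); rewrite invgM invgK mulgA mulgK.
    by have := YM Yg Yxy; rewrite mulgA mulgK.
  rewrite rE eqxx mulr1 /vec rE.
  have Yx : Y ((rep y.1)^-1 * x.1)%g by rewrite -rE.
  have Yy := repP y.1.
  have -> : (y.1^-1 * x.1)%g = (((rep y.1)^-1 * y.1)^-1 * ((rep y.1)^-1 * x.1))%g.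
    by rewrite invgM invgK -mulgA mulVKg.
  rewrite extend0_in; last by apply: YM => //; exact: YV.
  rewrite alphaM //; last exact: YV.
  by rewrite /= alphaV_adj // !extend0_in.
have -> : rep x.1 == rep y.1 = false.
  apply/negP => /eqP rE; apply: nY; have := YM (YV (repP y.1)) (repP x.1).
  by rewrite -rE invgM invgK -mulgA mulVKg.
by rewrite mulr0 /extend0 ifF ?inner0l //; apply/negP => /set_mem.
Qed.

Let ker : pdKernel R X := schur_kernel (delta_kernel R (fun z : X => rep z.1)) vec.
Let act (s : H) (x : X) : X := ((s * x.1)%g, x.2).

Let act1 x : act 1%g x = x. Proof. by case: x => h i; rewrite /act mul1g. Qed.

Let actM s t x : act (s * t)%g x = act s (act t x).
Proof. by rewrite /act mulgA. Qed.

Let ker_inv s x y : ker (act s x) (act s y) = ker x y.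
Proof. by rewrite -!coset_kernelE /= invgM -mulgA mulKg. Qed.

Let ker_cts x y : continuous (fun s => ker (act s x) y : C^o).
Proof.
have -> : (fun s => ker (act s x) y : C^o) =
    (fun s => inner (ext (y.1^-1 * s * x.1)%g (xi x.2)) (xi y.2)).
  by apply/funext => s; rewrite /ker -coset_kernelE /= mulgA.
move=> s; exact: (@cvg_comp _ _ _ (fun s => (y.1^-1 * s * x.1)%g)
  (fun h => inner (ext h (xi x.2)) (xi y.2) : C^o) _ _ _
  (@mulg_cvg y.1^-1%g x.1 s) (@extend0_continuous _ _ _)).
Qed.

(** The same representation and the same vectors serve all pairs of indices;
    positivity of matrices over W^*(H) can then be tested on it. *)
Lemma extend0_coef : exists (W : hilbertType R) (sigma : H -> W -> W) (eta : 'I_n -> W),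
  cts_unitary_rep sigma /\
  forall i j h, coef sigma (eta i) (eta j) h = inner (ext h (xi i)) (xi j).
Proof.
exists (rkhs ker), (rkhs_act ker_inv), (fun i => rkhs_vec ker (1%g, i)).
split; first exact: rkhs_act_rep.
move=> i j h; rewrite /coef rkhs_act_vec // inner_rkhs_vec -coset_kernelE /=.
by rewrite invg1 mul1g mulg1.
Qed.

End CoefficientKernel.

Lemma homomorphism_completely_positive (phi : (G -> C) -> H -> C) :
  (forall u, coef_space pi u -> phi u = jmap pi Y alpha u) ->
  completely_positive pi phi.
Proof.
move=> phi_j n T [_ Tpos] xi; have [W [sigma [eta [hs etaE]]]] := extend0_coef xi.
have := Tpos W sigma hs eta; congr (0 <= _).
apply: eq_bigr => i _; apply: eq_bigr => j _ /=; congr (T i j _).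
by apply/funext => h; rewrite etaE (phi_coef pi_rep alpha_spec phi_j).
Qed.

End HomomorphismToPositive.

(** * The characterization *)

Theorem corollary4p3 (R : realType) (G H : lcGroupType) (V : hilbertType R)
  (pi : G -> V -> V) (pi_rep : cts_unitary_rep pi)
  (A_alg : closed_unital_invariant_subalgebra (coef_space pi))
  (Y : set H) (Y_open : open Y)
  (alpha : H -> V -> V) (alpha_spec : alpha @` Y `<=` spectrum pi)
  (alpha_cts : weakstar_continuous_on pi Y alpha)
  (phi : (G -> R[i]) -> H -> R[i])
  (phi_hom : algebra_hom (coef_space pi) (@fourier_stieltjes R H) phi)
  (phi_nz : exists2 u, coef_space pi u & phi u <> (fun=> 0))
  (phi_j : forall u, coef_space pi u -> phi u = jmap pi Y alpha u) :
  [<-> n_positive pi 4 phi /\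
         (exists S, subgroup_of_spectrum pi S /\ alpha @` Y `<=` S);
       completely_positive pi phi /\
         (exists S, subgroup_of_spectrum pi S /\ alpha @` Y `<=` S);
       [/\ open_subgroup Y,
           weakstar_continuous_on pi Y alpha,
           forall h k, Y h -> Y k -> alpha (h * k)%g = alpha h \o alpha k &
           exists p, [/\ spectrum pi p, is_projection p &
             alpha @` Y `<=` spectrum_block pi p]]].
Proof.
have pos_hom : n_positive pi 4 phi ->
    (exists S, subgroup_of_spectrum pi S /\ alpha @` Y `<=` S) ->
    [/\ open_subgroup Y,
        forall h k, Y h -> Y k -> alpha (h * k)%g = alpha h \o alpha k &
        exists p, [/\ spectrum pi p, is_projection p &
          alpha @` Y `<=` spectrum_block pi p]].
  move=> pos4 [S [SS aS]].
  exact: (positive_homomorphism pi_rep A_alg alpha_spec phi_nz phi_j Y_open pos4 SS aS).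
have hom_cp : open_subgroup Y ->
    (forall h k, Y h -> Y k -> alpha (h * k)%g = alpha h \o alpha k) ->
    (exists p, [/\ spectrum pi p, is_projection p &
      alpha @` Y `<=` spectrum_block pi p]) ->
    completely_positive pi phi /\
    (exists S, subgroup_of_spectrum pi S /\ alpha @` Y `<=` S).
  move=> Ysub aM [p [_ pp ap]]; split.
    exact: (homomorphism_completely_positive pi_rep alpha_spec alpha_cts Ysub aM pp ap phi_j).
  by exists (alpha @` Y); split; first exact: image_subgroup.
tfae.
- by move=> [pos4 SS]; have [Ysub aM ap] := pos_hom pos4 SS; exact: hom_cp.
- by move=> [cp SS]; have [Ysub aM ap] := pos_hom (cp 4%N) SS.
- by move=> [Ysub _ aM ap]; have [cp SS] := hom_cp Ysub aM ap; split; first exact: cp.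
Qed.
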